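(* For any fixed tree $T$ with $k$ vertices, there exists a randomized algorithm that, given query access to an $N$-vertex graph $G$ of constant degree bound $d$ that is $\epsilon$-far from being $T$-minor free, finds a $T$-minor in $G$ in expected time $\mathrm{poly}(d^D)$, where $D=k(16d/\epsilon)^{4k+2}$.
   Context: Graphs are $G=([N],E)$ with maximum degree at most $d$, accessed via neighbor queries (for $v\in[N]$, $1\le i\le d$, the $i$-th neighbor of $v$, or $0$ if none); vertex-manipulation operations cost unit time. A graph $G$ has an $H$-minor if $H$ can be obtained from $G$ by a sequence of vertex deletions, edge deletions and edge contractions; $G$ is $H$-minor free if it has no $H$-minor. $G$ is $\epsilon$-far from being $T$-minor free if for every $T$-minor free graph $G'=([N],E')$ the symmetric difference of $E$ and $E'$ has more than $\epsilon dN$ elements. Finding a $T$-minor means exhibiting a subgraph of $G$ together with a partition of part of its vertices into connected sets witnessing that $T$ is a minor of $G$.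
   Formalization: The degree bound is taken to be d ≥ 2, since for d = 1 (T an edge, G a sparse matching) the literal bound poly(1^D) is constant and the claim fails; ε is a positive rational, a real ε being handled by a slightly smaller rational one. *)

(* Defs.v *)
From HB Require Import structures.
From mathcomp Require Import all_boot all_order all_algebra.
From mathcomp Require Import all_classical all_reals all_analysis.
Set Implicit Arguments.
Unset Strict Implicit.
Unset Printing Implicit Defensive.
Import Order.TTheory GRing.Theory Num.Theory.
Local Open Scope ring_scope.

Record sgraph (V : finType) := SGraph {
  adj :> rel V;
  adj_sym : symmetric adj;
  adj_irr : irreflexive adj }.

Section Operations.
Variables (V : finType) (G : sgraph V).

Definition del_vertex_rel (x : V) : rel {z : V | z != x} :=
  fun u v => G (val u) (val v).

Lemma del_vertex_sym x : symmetric (@del_vertex_rel x).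
Proof. by move=> u v; rewrite /del_vertex_rel adj_sym. Qed.

Lemma del_vertex_irr x : irreflexive (@del_vertex_rel x).
Proof. by move=> u; rewrite /del_vertex_rel adj_irr. Qed.

Definition del_vertex (x : V) : sgraph {z : V | z != x} :=
  SGraph (@del_vertex_sym x) (@del_vertex_irr x).

Definition del_edge_rel (x y : V) : rel V :=
  fun u v => G u v && ([set u; v] != [set x; y])%SET.

Lemma del_edge_sym x y : symmetric (del_edge_rel x y).
Proof. by move=> u v; rewrite /del_edge_rel adj_sym finset.setUC. Qed.

Lemma del_edge_irr x y : irreflexive (del_edge_rel x y).
Proof. by move=> u; rewrite /del_edge_rel adj_irr. Qed.

Definition del_edge (x y : V) : sgraph V :=
  SGraph (@del_edge_sym x y) (@del_edge_irr x y).

(* Contraction of the edge xy: y disappears and x is the merged vertex; loops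
   and parallel edges are suppressed. *)
Definition contract_rel (x y : V) : rel {z : V | z != y} :=
  fun u v => (u != v) &&
    [|| G (val u) (val v), (val u == x) && G y (val v)
      | (val v == x) && G (val u) y].

Lemma contract_sym x y : symmetric (@contract_rel x y).
Proof.
move=> u v; rewrite /contract_rel eq_sym; congr (_ && _).
rewrite (adj_sym G (val v) (val u)) (adj_sym G y (val u)).
by rewrite (adj_sym G (val v) y); congr (_ || _); rewrite orbC.
Qed.

Lemma contract_irr x y : irreflexive (@contract_rel x y).
Proof. by move=> u; rewrite /contract_rel eqxx. Qed.

Definition contract (x y : V) : sgraph {z : V | z != y} :=
  SGraph (@contract_sym x y) (@contract_irr x y).

Definition edges : {set {set V}} :=
  [set [set p.1; p.2]%SET | p in [pred p : V * V | G p.1 p.2]]%SET.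

Definition max_degree_le (d : nat) : Prop :=
  forall v : V, (#|[pred w | G v w]| <= d)%N.

Definition connected_graph : Prop :=
  (0 < #|V|)%N /\ forall x y : V, connect G x y.

Definition acyclic : Prop :=
  forall c : seq V, (2 < size c)%N -> ~~ ucycleb G c.

Definition is_tree : Prop := connected_graph /\ acyclic.

Definition connected_set (S : {set V}) : Prop :=
  (S != finset.set0) /\
  forall x y, x \in S -> y \in S ->
    connect [rel u v | [&& u \in S, v \in S & G u v]] x y.

End Operations.

Definition isomorphic (V W : finType) (G : sgraph V) (H : sgraph W) : Prop :=
  exists2 f : V -> W, bijective f & forall x y, H (f x) (f y) = G x y.

(* [has_minor H G]: H is obtained, up to isomorphism, from G by a sequence of
   vertex deletions, edge deletions and edge contractions. *)
Inductive has_minor (W : finType) (H : sgraph W) :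
    forall V : finType, sgraph V -> Prop :=
| Minor_iso (V : finType) (G : sgraph V) :
    isomorphic G H -> has_minor H G
| Minor_del_vertex (V : finType) (G : sgraph V) (x : V) :
    has_minor H (del_vertex G x) -> has_minor H G
| Minor_del_edge (V : finType) (G : sgraph V) (x y : V) :
    G x y -> has_minor H (del_edge G x y) -> has_minor H G
| Minor_contract (V : finType) (G : sgraph V) (x y : V) :
    G x y -> has_minor H (contract G x y) -> has_minor H G.

Definition minor_free (W : finType) (H : sgraph W) (V : finType)
  (G : sgraph V) : Prop := ~ has_minor H G.

Definition symdiff_size (V : finType) (G G' : sgraph V) : nat :=
  #|((edges G :\: edges G') :|: (edges G' :\: edges G))%SET|.

Definition far_from_minor_free (W : finType) (T : sgraph W) (d N : nat)
    (eps : rat) (G : sgraph 'I_N) : Prop :=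
  forall G' : sgraph 'I_N, minor_free T G' ->
    eps * d%:R * N%:R < (symdiff_size G G')%:R.

(* F is a subgraph of G with vertex set X, and the sets B t, one for each
   vertex t of T, partition a part of X into connected sets of F that witness
   that T is a minor of G. *)
Definition minor_witness (W : finType) (T : sgraph W) (V : finType)
    (G : sgraph V) (X : {set V}) (F : sgraph V) (B : W -> {set V}) : Prop :=
  [/\ (forall u v, F u v -> [&& u \in X, v \in X & G u v]),
      (forall t, B t \subset X),
      (forall t t', t != t' -> [disjoint B t & B t']),
      (forall t, connected_set F (B t))
    & (forall t t', T t t' ->
         exists u v, [/\ u \in B t, v \in B t' & F u v])].

(* What an algorithm prints: a list of vertices, each with a label, and a list
   of edges.  In all machine-level data the vertex v : 'I_N is named v.+1 (so
   that names range over {1, ..., N}); label t.+1 means "in the part of the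
   vertex t : 'I_k of T", and label 0 means "in no part". *)
Record output := Output {
  out_vertices : seq (nat * nat);
  out_edges : seq (nat * nat) }.

Definition out_describes (k N : nat) (o : output) (X : {set 'I_N})
    (F : sgraph 'I_N) (B : 'I_k -> {set 'I_N}) : Prop :=
  [/\ (forall a l, (a, l) \in out_vertices o ->
         (0 < a <= N)%N /\ (l <= k)%N),
      (forall a b, (a, b) \in out_edges o ->
         (0 < a <= N)%N /\ (0 < b <= N)%N),
      (forall v : 'I_N, (v \in X) = (v.+1 \in unzip1 (out_vertices o))),
      (forall (t : 'I_k) (v : 'I_N),
         (v \in B t) = ((v.+1, t.+1) \in out_vertices o))
    & (forall u v : 'I_N, F u v = ((u.+1, v.+1) \in out_edges o)
                               || ((v.+1, u.+1) \in out_edges o))].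

Definition output_is_minor (k N : nat) (T : sgraph 'I_k) (G : sgraph 'I_N)
    (o : output) : Prop :=
  exists X F B, out_describes o X F B /\ minor_witness T G X F B.

(* A random-access machine with an unbounded memory of natural numbers, given
   as a structured language.  Arithmetic is restricted to addition and
   truncated subtraction, so that unit cost per operation is not abusive. *)
Inductive expr :=
| Const of nat
| Mem of expr
| Add of expr & expr
| Sub of expr & expr.

Inductive cmd :=
| Skip
| Store of expr & expr            (* address, value *)
| Query of expr & expr & expr     (* address, vertex v, index i *)
| RandVertex of expr              (* address *)
| Coin of expr                    (* address *)
| PrintVertex of expr & expr      (* vertex, label *)
| PrintEdge of expr & expr        (* the two end-points *)
| Seq of cmd & cmd
| If of expr & cmd & cmd          (* nonzero means true *)
| While of expr & cmd.

Definition memory := nat -> nat.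

Fixpoint eval (m : memory) (e : expr) : nat :=
  match e with
  | Const n => n
  | Mem a => m (eval m a)
  | Add e1 e2 => (eval m e1 + eval m e2)%N
  | Sub e1 e2 => (eval m e1 - eval m e2)%N
  end.

Definition update (m : memory) (a x : nat) : memory :=
  fun b => if b == a then x else m b.

(* The first component of a configuration is the stack of commands that remain
   to be run; the machine has halted when it is empty. *)
Record config := Config {
  todo : seq cmd;
  mem : memory;
  out : output }.

Definition halted (c : config) : bool := nilp (todo c).

Section Semantics.
Variables (N : nat) (nbr : 'I_N -> seq 'I_N).

(* The name of the i-th neighbor (i >= 1) of the vertex named a, or 0. *)
Definition answer (a i : nat) : nat :=
  if (a, i) is (a'.+1, i'.+1) then
    if insub a' is Some v then nth 0%N [seq (w : 'I_N).+1 | w <- nbr v] i'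
    else 0%N
  else 0%N.

(* The equiprobable configurations after one unit of time.  The expressions of
   a fixed program have bounded size, so charging a constant for a command
   together with its expressions is accurate up to a constant factor. *)
Definition step (c : config) : seq config :=
  let: Config s m o := c in
  if s is x :: s' then
    match x with
    | Skip => [:: Config s' m o]
    | Store a e => [:: Config s' (update m (eval m a) (eval m e)) o]
    | Query a v i =>
        [:: Config s' (update m (eval m a) (answer (eval m v) (eval m i))) o]
    | RandVertex a =>
        [seq Config s' (update m (eval m a) v) o | v <- iota 1 N]
    | Coin a =>
        [seq Config s' (update m (eval m a) b) o | b <- [:: 0%N; 1%N]]
    | PrintVertex v l =>
        [:: Config s' m (Output (rcons (out_vertices o) (eval m v, eval m l))
                                (out_edges o))]
    | PrintEdge u v =>
        [:: Config s' m (Output (out_vertices o)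
                                (rcons (out_edges o) (eval m u, eval m v)))]
    | Seq x1 x2 => [:: Config (x1 :: x2 :: s') m o]
    | If e x1 x2 =>
        [:: Config ((if eval m e != 0%N then x1 else x2) :: s') m o]
    | While e x1 =>
        [:: Config (if eval m e != 0%N then x1 :: x :: s' else s') m o]
    end
  else [:: c].

(* The probability that the machine, started in c, halts after exactly t steps
   with an output satisfying P. *)
Fixpoint halt_prob (R : realType) (P : output -> Prop) (t : nat)
    (c : config) : R :=
  match t with
  | 0%N => (halted c && `[< P (out c) >])%:R
  | t'.+1 => if halted c then 0
             else (\sum_(c' <- step c) halt_prob R P t' c')
                    / (size (step c))%:R
  end.

Definition almost_surely_outputs (R : realType) (P : output -> Prop)
    (c : config) : Prop :=
  (\sum_(0 <= t <oo) (halt_prob R P t c)%:E = 1)%E.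

Definition expected_time (R : realType) (c : config) : \bar R :=
  (\sum_(0 <= t <oo) (t%:R * halt_prob R (fun=> True) t c)%:E)%E.

End Semantics.

(* The input N, d, eps (numerator and denominator) is in the first four memory
   cells; all other cells contain 0. *)
Definition input (N d : nat) (eps : rat) : memory :=
  nth 0%N [:: N; d; `|numq eps|%N; `|denq eps|%N].

Definition start (A : cmd) (N d : nat) (eps : rat) : config :=
  Config [:: A] (input N d eps) (Output [::] [::]).

(* [nbr v] lists the neighbors of v in an arbitrary order without repetition. *)
Definition neighbor_lists (N : nat) (G : sgraph 'I_N)
    (nbr : 'I_N -> seq 'I_N) : Prop :=
  forall v, uniq (nbr v) /\ forall w, (w \in nbr v) = G v w.

Definition depth (R : realType) (k d : nat) (eps : rat) : R :=
  k%:R * (16 * d%:R / ratr eps) ^+ (4 * k + 2).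

(* Submission.v *)
Require Import Defs.
From HB Require Import structures.
From mathcomp Require Import all_boot all_order all_algebra.
From mathcomp Require Import boolp.
From mathcomp Require Import zify ring lra.
Set Implicit Arguments.
Unset Strict Implicit.
Unset Printing Implicit Defensive.
Import Order.TTheory GRing.Theory Num.Theory.

(** A trial of the algorithm starts at a random vertex and grows a labelled tree
    at random: it guesses an explored vertex x and a neighbor w of x, and either
    puts w into the branch set of x or lets w open the next branch set, the
    vertices of T being taken in an order in which each one is adjacent to exactly
    one earlier one.  If the start lies in the first branch set of a T-model with
    at most s vertices, all guesses are right with probability at least
    2^-(s (s + d + 3)), so the expected time is about the inverse of this number
    divided by the density of such starts.

    Let M be the set of these starts, for s about 2k / eps.  If M had fewer than
    eps N / 2 elements, delete the edges at M and then, repeatedly, cut off from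
    the rest U a set of at most s vertices with at most (eps / 2) d edges per
    vertex to its complement in U.  If this never gets stuck, all components have
    at most s vertices and avoid M, so that few deletions make G free of T.  If it
    gets stuck at U, sets of at most s vertices with at most k boundary vertices
    have fewer than s vertices, and Diestel's proof of the path-width theorem
    yields a small T-model inside U: take X maximal with i boundary vertices, each
    in its own branch set, add a vertex outside X adjacent to the right one of
    them, and extend the branch sets by Menger's theorem to the boundary of a set
    maximal with i + 1 boundary vertices. *)

(** * Boundaries and disjoint connections *)

(** [e] need not be symmetric: the proof of [linkage] deletes single arcs. *)
HB.lock Definition bd (V : finType) (e : rel V) (Z : {set V}) : {set V} :=
  [set z in Z | [exists w, (w \notin Z) && e z w]].

Section Boundary.
Variable V : finType.
Implicit Types (e : rel V) (A X Z : {set V}).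


Lemma bdP e Z z :
  reflect (z \in Z /\ exists2 w, w \notin Z & e z w) (z \in bd e Z).
Proof.
rewrite bd.unlock inE; apply: (iffP andP) => -[zZ].
  by case/existsP=> w /andP[wZ ezw]; split => //; exists w.
by case=> w wZ ezw; split => //; apply/existsP; exists w; rewrite wZ.
Qed.

Lemma bd_sub e Z : bd e Z \subset Z.
Proof. by apply/subsetP => z /bdP[]. Qed.

Lemma bd_setU1 e Z u : bd e (u |: Z) \subset u |: bd e Z.
Proof.
apply/subsetP => z /bdP[]; rewrite !inE => /orP[-> //|zZ] [w].
rewrite !inE => /norP[_ wZ] ezw; apply/orP; right.
by apply/bdP; split=> //; exists w.
Qed.

Lemma connected_set1 (G : sgraph V) x : connected_set G [set x].
Proof.
split; first by apply/set0Pn; exists x; rewrite set11.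
by move=> y z /set1P-> /set1P->.
Qed.

Lemma connected_setU (G : sgraph V) A B x :
  connected_set G A -> connected_set G B -> x \in A -> x \in B ->
  connected_set G (A :|: B).
Proof.
move=> [A0 cA] [B0 cB] xA xB; split.
  by apply/set0Pn; exists x; rewrite inE xA.
set r := (X in connect X).
have rsym : connect_sym r.
  by apply: sym_connect_sym => u v; rewrite /r /= adj_sym andbCA.
have sub (C : {set V}) : C \subset A :|: B ->
    subrel (connect [rel u v | [&& u \in C, v \in C & G u v]]) (connect r).
  move=> /subsetP sC; apply: connect_sub => u v /= /and3P[uC vC Guv].
  by apply: connect1; rewrite /r /= !sC.
have tox y : y \in A :|: B -> connect r y x.
  case/setUP => yS.
    by apply: (sub A (subsetUl _ _)); apply: cA.
  by apply: (sub B (subsetUr _ _)); apply: cB.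
by move=> y z /tox cy /tox cz; apply: connect_trans cy _; rewrite rsym.
Qed.

Lemma connected_set2 (G : sgraph V) x y : G x y -> connected_set G [set x; y].
Proof.
move=> Gxy; split; first by apply/set0Pn; exists x; rewrite set21.
move=> u v; rewrite !inE.
by case/orP=> /eqP-> /orP[]/eqP-> //; apply: connect1 => /=;
  rewrite !inE !eqxx ?orbT //= adj_sym.
Qed.

(** The sets [Q a] stand for the disjoint paths of Menger's theorem. They are connected in [G],
    while boundaries refer to [e], so that arcs of [e] can be deleted without harm to them. *)
Definition linked (G : sgraph V) e A X :=
  exists (Q : V -> {set V}) (h : V -> V),
  (forall a, a \in bd e A -> [/\ a \in Q a, h a \in Q a, h a \in bd e X,
      connected_set G (Q a) & Q a \subset (X :\: A) :|: bd e A]) /\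
  (forall a b, a \in bd e A -> b \in bd e A -> a != b -> [disjoint Q a & Q b]).

Lemma linked_bd (G : sgraph V) e A X : bd e A \subset bd e X -> linked G e A X.
Proof.
move=> /subsetP sub; exists (fun a => [set a]), id; split.
  move=> a aA; rewrite set11 sub //; split => //; first exact: connected_set1.
  by rewrite sub1set inE aA orbT.
by move=> a b _ _ neq; rewrite disjoints1 inE.
Qed.

(** By counting, [h] is a bijection between the boundaries of [A] and [Z], so [Q a] can be continued
    by [Q' (h a)]. *)
Lemma linked_trans (G : sgraph V) e A Z X : A \subset Z -> Z \subset X ->
  #|bd e A| = #|bd e Z| -> linked G e A Z -> linked G e Z X -> linked G e A X.
Proof.
move=> AZ ZX card [Q [h [HQ dQ]]] [Q' [h' [HQ' dQ']]].
have hinj : {in bd e A &, injective h}.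
  move=> a b aA bA hab; apply/eqP; apply: contraT => neq.
  have /pred0P/(_ (h a)) := dQ _ _ aA bA neq.
  by have [_ /= -> _ _ _] := HQ _ aA; have [_ ] := HQ _ bA; rewrite -hab => ->.
have hsurj y : y \in bd e Z -> exists2 a, a \in bd e A & y = h a.
  have /eqP <- : h @: bd e A == bd e Z.
    rewrite eqEcard card_in_imset // card leqnn andbT.
    by apply/subsetP => _ /imsetP[a aA ->]; have [] := HQ _ aA.
  by case/imsetP => a aA ->; exists a.
exists (fun a => Q a :|: Q' (h a)), (fun a => h' (h a)); split.
  move=> a aA; have [aQ haQ haZ cQ sQ] := HQ _ aA.
  have [haQ' hhQ' hhX cQ' sQ'] := HQ' _ haZ.
  split; rewrite ?inE ?aQ ?hhQ' ?orbT //; first exact: (connected_setU cQ cQ' haQ haQ').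
  apply/subsetP => y /setUP[/(subsetP sQ)|/(subsetP sQ')]; rewrite !in_setU.
    by case/orP => [/setDP[yZ yA]|->]; rewrite ?orbT // inE yA (subsetP ZX).
  case/orP => [/setDP[yX yZ]|yZ]; last first.
    have [b bA ->] := hsurj _ yZ; have [_ hbQ _ _ /subsetP/(_ _ hbQ)] := HQ _ bA.
    by rewrite inE => /orP[/setDP[bZ bnA]|->]; rewrite ?orbT // inE bnA (subsetP ZX).
  by rewrite inE yX andbT; apply/orP; left; apply: contra yZ; exact: (subsetP AZ).
have eqQ a b y : a \in bd e A -> b \in bd e A -> y \in Q a -> y \in Q b -> a = b.
  move=> aA bA ya yb; apply/eqP; apply: contraT => neq.
  by have /pred0P/(_ y) := dQ _ _ aA bA neq; rewrite /= ya yb.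
have eqQ' a b y :
    a \in bd e Z -> b \in bd e Z -> y \in Q' a -> y \in Q' b -> a = b.
  move=> aA bA ya yb; apply/eqP; apply: contraT => neq.
  by have /pred0P/(_ y) := dQ' _ _ aA bA neq; rewrite /= ya yb.
(* [Q a] lies in [Z], and [Q' (h b)] meets [Z] only in its boundary; so a common point is a boundary
   vertex of [Z], and such a vertex lies in just one [Q] and one [Q']. *)
have meet a b y : a \in bd e A -> b \in bd e A -> y \in Q a ->
    y \in Q' (h b) -> a = b.
  move=> aA bA yQ yQ'; have [_ haQ _ _ /subsetP/(_ _ yQ) yZA] := HQ _ aA.
  have [_ _ hbZ _ _] := HQ _ bA.
  have [hbQ' _ _ _ /subsetP/(_ _ yQ') yXZ] := HQ' _ hbZ.
  have yZ : y \in Z.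
    case/setUP: yZA => [/setDP[]//|/(subsetP (bd_sub _ _))].
    exact: (subsetP AZ).
  have {yXZ} ybZ : y \in bd e Z.
    by case/setUP: yXZ => // /setDP[_]; rewrite yZ.
  have [c cA yc] := hsurj _ ybZ; have [_ hcQ _ _ _] := HQ _ cA.
  have ca : c = a by apply: eqQ yQ => //; rewrite yc.
  have [yQy _ _ _ _] := HQ' _ ybZ.
  by apply: hinj => //; rewrite -ca -yc; exact: eqQ' yQy yQ'.
move=> a b aA bA neq; apply/pred0P => y /=; apply/negP => /andP[].
have [_ _ haZ _ _] := HQ _ aA; have [_ _ hbZ _ _] := HQ _ bA.
case/setUP=> ya /setUP[] yb; case/eqP: neq.
- exact: eqQ ya yb.
- exact: meet ya yb.
- by apply/esym; exact: meet yb ya.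
- by apply: hinj => //; exact: eqQ' ya yb.
Qed.

(** Menger's theorem for nested sets, by induction on the size of [X :\: A] plus the number of arcs.
    Either no arc leads from the boundary of [A] into [X :\: A], or a set strictly between has an
    equally large boundary and splits the problem, or [X] is [b |: A], or an arc can be deleted. *)
Lemma linkage (G : sgraph V) e A X :
  subrel e G -> A \subset X -> #|bd e A| = #|bd e X| ->
  (forall Z, A \subset Z -> Z \subset X -> #|bd e A| <= #|bd e Z|) ->
  linked G e A X.
Proof.
move: {2}(_ + _) (leqnn (#|X :\: A| + #|[set p | e p.1 p.2]|)) => n.
elim: n e A X => [|n IH] e A X le_n eG AX cX minA.
  apply: linked_bd; suff -> : bd e A = bd e X by [].
  move: le_n; rewrite leqn0 addn_eq0 => /andP[/eqP/cards0_eq/eqP].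
  rewrite setD_eq0 => XA _.
  by have -> : A = X by apply/eqP; rewrite eqEsubset AX.
have [|/existsPn noe] := boolP [exists a in bd e A, exists b in X :\: A, e a b];
  last first.
  apply: linked_bd; apply/subsetP => a /[dup] aA /bdP[aA' [w wA eaw]].
  apply/bdP; split; first exact: (subsetP AX).
  exists w => //; apply/negP => wX; have := noe a.
  by rewrite aA /= => /existsPn/(_ w); rewrite inE wA wX eaw.
case/exists_inP => a aA /exists_inP[b /setDP[bX bA] eab].
have [/existsP[Z /and3P[AZ ZX /eqP cZ]]|/existsPn noZ] :=
  boolP [exists Z : {set V}, [&& A \proper Z, Z \proper X & #|bd e Z| == #|bd e A|]].
  have [AZ' ZX'] := (proper_sub AZ, proper_sub ZX).
  have cXZ : #|X :\: A| = #|X :\: Z| + #|Z :\: A|.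
    rewrite !cardsD (setIidPr AX) (setIidPr AZ') (setIidPr ZX').
    have := subset_leq_card AZ'; have := subset_leq_card ZX'; lia.
  have AZl := proper_card AZ; have ZXl := proper_card ZX.
  move: le_n; rewrite cXZ => le_n.
  have pA : 0 < #|Z :\: A| by rewrite cardsD (setIidPr AZ') subn_gt0.
  have pZ : 0 < #|X :\: Z| by rewrite cardsD (setIidPr ZX') subn_gt0.
  apply: (@linked_trans G e A Z X) => //.
    apply: IH => // [|Y AY YZ]; first lia.
    by apply: minA => //; exact: subset_trans YZ ZX'.
  apply: IH => // [||Y ZY YX]; [lia|by rewrite cZ|].
  by rewrite cZ; apply: minA => //; exact: subset_trans AZ' ZY.
have ltZ Z : A \proper Z -> Z \proper X -> #|bd e A| < #|bd e Z|.
  move=> AZ ZX; have := noZ Z; rewrite AZ ZX /= => neq.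
  by rewrite ltn_neqAle eq_sym neq minA // proper_sub.
have AbX : b |: A \subset X by rewrite subUset sub1set bX.
have AAb : A \proper b |: A by rewrite properE subsetU1 subUset sub1set (negbTE bA).
have [XE|XN] := eqVneq (b |: A) X.
  have [|/subsetPn[a' a'A a'X]] := boolP (bd e A \subset bd e X).
    exact: linked_bd.
  (* [a'] is no boundary vertex of [X], so its arcs leaving [A] all end in [b]. It gets linked to
     [b], and every other boundary vertex to itself. *)
  have ea'b : e a' b.
    case/bdP: (a'A) => a'A' [w wA ea'w]; suff -> : b = w by [].
    apply/eqP; apply: contraNT a'X => neq; apply/bdP.
    by split; [exact: (subsetP AX)|exists w => //; rewrite -XE !inE eq_sym (negbTE neq)].
  have bdX : bd e X = b |: (bd e A :\ a').
    apply/eqP; rewrite eqEcard; apply/andP; split.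
      apply/subsetP => z /[dup] zX; rewrite -{1}XE => /(subsetP (bd_setU1 _ _ _)).
      rewrite !in_setU1 in_setD1 => /orP[->//|->]; rewrite andbT.
      by apply/orP; right; apply: contraNneq a'X => <-.
    rewrite cardsU1 -cX [#|bd e A|](cardsD1 a') a'A leq_add //.
    by case: (_ \notin _).
  have a'b : a' != b.
    by apply: contraNneq bA => <-; apply: (subsetP (bd_sub e A)).
  exists (fun z => if z == a' then [set a'; b] else [set z]),
         (fun z => if z == a' then b else z); split.
    move=> z zA; have [->|neq] := eqVneq z a'.
      rewrite set21 set22 bdX setU11; split => //; first exact/connected_set2/eG.
      by rewrite subUset !sub1set !inE bX bA a'A !orbT.
    rewrite set11 bdX !inE neq zA orbT; split => //; first exact: connected_set1.
    by rewrite sub1set inE zA orbT.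
  have bn z : z \in bd e A -> z != b.
    by move=> /(subsetP (bd_sub e A)) zA; apply: contraNneq bA => <-.
  move=> y z yA zA yz; have [ya|ya] := eqVneq y a'.
    have [za|za] := eqVneq z a'; first by rewrite ya za eqxx in yz.
    by rewrite disjoint_sym disjoints1 !inE (negbTE za) (negbTE (bn _ zA)).
  have [za|za] := eqVneq z a'; rewrite disjoints1 !inE //.
  by rewrite (negbTE ya) (negbTE (bn _ yA)).
(* A + b lies strictly between A and X, so its boundary has more elements than
   that of A: hence a keeps another edge leaving A, and the edge a -> b can be
   deleted without destroying the hypotheses. *)
have AbX' : b |: A \proper X by rewrite properEneq XN.
pose e' := [rel u v | e u v && ((u, v) != (a, b))].
have e'e : subrel e' e by move=> u v /= /andP[].
have bde' Z : bd e' Z \subset bd e Z.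
  by apply/subsetP => z /bdP[zZ [w wZ /e'e ezw]]; apply/bdP; split => //; exists w.
have bdD Z : bd e Z :\ a \subset bd e' Z.
  apply/subsetP => z /setD1P[za /bdP[zZ [w wZ ezw]]]; apply/bdP; split => //.
  by exists w => //=; rewrite ezw xpair_eqE (negbTE za).
have bdA : bd e' A = bd e A.
  apply/eqP; rewrite eqEsubset bde' /=; apply/subsetP => z zA.
  have [za|za] := eqVneq z a; last by apply: (subsetP (bdD A)); rewrite !inE za.
  move: zA; rewrite {z}za => _; apply: contraT => naA.
  have := ltZ _ AAb AbX'; rewrite ltnNge => /negP[].
  apply: (@leq_trans #|b |: (bd e A :\ a)|); last first.
    by rewrite [#|bd e A|](cardsD1 a) aA cardsU1 leq_add //; case: (_ \notin _).
  apply: subset_leq_card; apply/subsetP => z /[dup] zZ /(subsetP (bd_setU1 _ _ _)).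
  rewrite !in_setU1 in_setD1 => /orP[->//|zA]; rewrite zA andbT.
  apply/orP; right; apply: contraNneq naA => za; move: zZ; rewrite za.
  case/bdP => _ [w]; rewrite in_setU1 => /norP[wb wA] eaw; apply/bdP.
  split; first by rewrite (subsetP (bd_sub e A)).
  by exists w => //=; rewrite eaw xpair_eqE (negbTE wb) andbF.
have bdX : bd e' X = bd e X.
  apply/eqP; rewrite eqEsubset bde' /=; apply/subsetP => z /bdP[zX [w wX ezw]].
  apply/bdP; split=> //; exists w => //=; rewrite ezw xpair_eqE negb_and orbC.
  by apply/orP; left; apply: contraNneq wX => ->.
have [|||Z AZ ZX|Q [h [HQ dQ]]] := IH e' A X _ _ AX.
- rewrite -ltnS (leq_trans _ le_n) // -addnS leq_add2l.
  apply: proper_card; rewrite properE; apply/andP; split.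
    by apply/subsetP => p; rewrite !inE => /e'e.
  by apply/subsetPn; exists (a, b); rewrite !inE /= ?eab ?eqxx.
- by move=> u v /e'e/eG.
- by rewrite bdA bdX.
(* Deleting the arc removes at most [a] from a boundary, and the sets strictly between [A] and [X]
   have a boundary vertex to spare. *)
- rewrite bdA; have [->|AnZ] := eqVneq Z A; first by rewrite bdA.
  have [->|ZnX] := eqVneq Z X; first by rewrite bdX cX.
  have ltc : #|bd e A| < #|bd e Z|.
    by apply: ltZ; rewrite properEneq ?AZ ?ZX ?andbT // eq_sym.
  rewrite -ltnS (leq_trans ltc) // (cardsD1 a (bd e Z)) -add1n.
  by rewrite leq_add ?leq_b1 ?subset_leq_card.
by exists Q, h; rewrite -bdA; split => // z zA; rewrite -bdX; exact: HQ.
Qed.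

End Boundary.

(** * Small models in graphs without sparse cuts *)

Section SmallModel.
Variables (V : finType) (G : sgraph V) (par : nat -> nat).

(** The tree has the vertices 0, ..., i - 1 and the edges between j > 0 and [par j], so one
    definition serves all its initial subtrees. *)
Definition tree_model i (B : nat -> {set V}) : Prop :=
  [/\ (forall j, j < i -> connected_set G (B j)),
      (forall j j', j < i -> j' < i -> j != j' -> [disjoint B j & B j'])
    & (forall j, 0 < j < i ->
        exists u v, [/\ u \in B (par j), v \in B j & G u v])].

(** Each branch set reaches the boundary of [X] at its root, from where it can receive a new
    neighbor or be linked to the boundary of a larger set. *)
Definition rooted_model e (X : {set V}) i (B : nat -> {set V}) (r : nat -> V) :=
  tree_model i B /\
  (forall j, j < i -> [/\ B j \subset X, r j \in B j & r j \in bd e X]).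

Hypothesis par_lt : forall i, 0 < i -> par i < i.

(** Each branch set absorbs the linking set at its root. By counting, the roots form the whole
    boundary of [A], so a linking set meets [A] in a single root and touches no other branch set. *)
Lemma rooted_model_linked (e : rel V) (A X : {set V}) i B r :
  A \subset X -> #|bd e A| = i ->
  linked G e A X -> rooted_model e A i B r ->
  exists B' r', rooted_model e X i B' r'.
Proof.
move=> AX cA [Q [h [HQ dQ]]] [[cB dB eB] HB].
have eqB j j' y : j < i -> j' < i -> y \in B j -> y \in B j' -> j = j'.
  move=> ji j'i yj yj'; apply/eqP; apply: contraT => neq.
  by have /pred0P/(_ y) := dB _ _ ji j'i neq; rewrite /= yj yj'.
have eqQ a b y : a \in bd e A -> b \in bd e A -> y \in Q a -> y \in Q b -> a = b.
  move=> aA bA ya yb; apply/eqP; apply: contraT => neq.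
  by have /pred0P/(_ y) := dQ _ _ aA bA neq; rewrite /= ya yb.
have rinj j j' : j < i -> j' < i -> r j = r j' -> j = j'.
  move=> ji j'i rr; have [_ rj _] := HB _ ji; have [_ rj' _] := HB _ j'i.
  by apply: eqB rj _ => //; rewrite rr.
have rsurj y : y \in bd e A -> exists2 j, j < i & y = r j.
  have /eqP <- : [set r (val j) | j : 'I_i] == bd e A.
    rewrite eqEcard cA card_imset ?card_ord ?leqnn ?andbT; last first.
      by move=> j j' rr; apply: val_inj; apply: rinj rr; exact: ltn_ord.
    by apply/subsetP => _ /imsetP[j _ ->]; have [] := HB _ (ltn_ord j).
  by case/imsetP => j _ ->; exists (val j) => //; exact: ltn_ord.
have meet j j' y : j < i -> j' < i -> y \in B j -> y \in Q (r j') -> j = j'.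
  move=> ji j'i yB yQ; have [BA rB rA] := HB _ ji; have [_ _ rA'] := HB _ j'i.
  have [_ _ _ _ /subsetP/(_ _ yQ)] := HQ _ rA'.
  case/setUP => [/setDP[_]|yA]; first by rewrite (subsetP BA).
  have [l li yl] := rsurj _ yA; have [_ rlB _] := HB _ li.
  have jl : j = l by apply: eqB yB _ => //; rewrite yl.
  have [yy _ _ _ _] := HQ _ yA.
  by rewrite jl; apply: rinj => //; rewrite -yl; exact: eqQ yy yQ.
exists (fun j => B j :|: Q (r j)), (fun j => h (r j)); split; first split.
- move=> j ji; have [BA rB rA] := HB _ ji; have [rQ _ _ cQ _] := HQ _ rA.
  exact: (connected_setU (cB _ ji) cQ rB rQ).
- move=> j j' ji j'i neq; apply/pred0P => y /=; apply/negP => /andP[].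
  have [_ _ rA] := HB _ ji; have [_ _ rA'] := HB _ j'i.
  case/setUP=> yj /setUP[] yj'; case/eqP: neq.
  + exact: eqB yj yj'.
  + exact: meet yj yj'.
  + by apply/esym; exact: meet yj' yj.
  + by apply: rinj => //; exact: eqQ yj yj'.
- move=> j ji; have [u [v [uB vB Guv]]] := eB _ ji.
  by exists u, v; rewrite !inE uB vB.
- move=> j ji; have [BA rB rA] := HB _ ji; have [rQ hQ hX cQ sQ] := HQ _ rA.
  split => //; last by rewrite inE hQ orbT.
  rewrite subUset (subset_trans BA AX) (subset_trans sQ) //.
  rewrite subUset subsetDl (subset_trans (bd_sub _ _)) //.
Qed.

Variables (U : {set V}) (s k : nat).
Let e := [rel u v | [&& u \in U, v \in U & G u v]].
Hypothesis U_neq0 : U != set0.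
Hypothesis bd_gt0 : forall S : {set V},
  S \subset U -> S != set0 -> #|S| <= s -> 0 < #|bd e S|.
(** The strict inequality leaves room for one more vertex. *)
Hypothesis bd_large : forall S : {set V},
  S \subset U -> #|S| <= s -> #|bd e S| <= k -> #|S| < s.

(* X is a largest set with at most i boundary vertices, so that by Menger's
   theorem each larger set can be reached from X by i + 1 disjoint paths. *)
Lemma rooted_model_stage i : i <= k ->
  exists (X : {set V}) B r, [/\ X \subset U, #|X| < s, #|bd e X| = i,
    (forall Z : {set V}, X \proper Z -> Z \subset U -> #|Z| <= s -> i < #|bd e Z|)
    & rooted_model e X i B r].
Proof.
elim: i => [|i IH] ik.
  have bd0 : bd e set0 = set0.
    by apply/eqP; rewrite -subset0 bd_sub.
  have [x xU] := set0Pn _ U_neq0.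
  exists set0, (fun=> set0), (fun=> x); split; rewrite ?sub0set ?bd0 ?cards0 //.
    by have := @bd_large set0; rewrite bd0 cards0 sub0set; apply.
    by move=> Z; rewrite proper0 => Z0 ZU Zs; exact: bd_gt0.
  by split=> //; split=> // j; rewrite ltn0 andbF.
have [X [B [r [XU Xs cX maxX [mB HB]]]]] := IH (ltnW ik).
(* For i = 0 the boundary of [X] is empty, hence so is [X], and any vertex of [U] serves. Otherwise
   the root of the parent has a neighbor in [U] outside [X]. *)
have [u [uU uX eu]] : exists u, [/\ u \in U, u \notin X &
    0 < i -> e (r (par i)) u].
  case: (posnP i) => [i0|i0].
    have [x xU] := set0Pn _ U_neq0.
    have X0 : X = set0.
      apply/eqP; apply: contraT => X0; have := bd_gt0 XU X0 (ltnW Xs).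
      by rewrite cX i0.
    by exists x; rewrite X0 inE.
  have [_ _ /bdP[_ [w wX erw]]] := HB _ (par_lt i0).
  by exists w; split => //; case/and3P: erw.
set A := u |: X.
have XA : X \proper A by rewrite properE subsetU1 subUset sub1set (negbTE uX).
have AU : A \subset U by rewrite subUset sub1set uU.
have As : #|A| <= s by rewrite cardsU1 uX.
(* One vertex adds at most one boundary vertex, and by the maximality of [X] at least one. *)
have cbA : #|bd e A| = i.+1.
  apply/eqP; rewrite eqn_leq maxX // andbT.
  rewrite (leq_trans (subset_leq_card (bd_setU1 e X u))) // cardsU1 cX.
  by case: (_ \notin _) => /=; lia.
have bdA : bd e A = u |: bd e X.
  apply/eqP; rewrite eqEcard bd_setU1 cbA cardsU1 cX.
  by case: (_ \notin _) => /=; lia.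
pose P (Z : {set V}) := [&& A \subset Z, Z \subset U, #|Z| <= s & #|bd e Z| <= i.+1].
have PA : P A by rewrite /P subxx AU As cbA leqnn.
have [X' /and4P[AX' X'U X's bX'] maxX'] := @arg_maxnP _ A P (fun Z => #|Z|) PA.
have XX' : X \proper X' by exact: proper_sub_trans XA AX'.
have cbX' : #|bd e X'| = i.+1 by apply/eqP; rewrite eqn_leq bX' maxX.
have lAX' : linked G e A X'.
  apply: linkage => //; first by move=> a b /and3P[].
    by rewrite cbA cbX'.
  move=> Z AZ ZX'; rewrite cbA; apply: maxX.
  - exact: proper_sub_trans XA AZ.
  - exact: subset_trans ZX' X'U.
  - by rewrite (leq_trans (subset_leq_card ZX')).
have [|B' [r' HB']] := @rooted_model_linked e A X' i.+1
    (fun j => if j == i then [set u] else B j)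
    (fun j => if j == i then u else r j) AX' cbA lAX'.
  case: mB => cB dB eB.
  have lti j : j < i.+1 -> j != i -> j < i.
    by move=> ji nji; rewrite ltn_neqAle nji -ltnS.
  have uB j : j < i -> u \notin B j.
    by move=> /HB[BX _ _]; apply: contra uX; exact: (subsetP BX).
  split; first split.
  - move=> j ji; have [_|ji'] := eqVneq j i; first exact: connected_set1.
    exact/cB/lti.
  - move=> j j' ji j'i neq; have [ji'|ji'] := eqVneq j i.
      have [j'i'|j'i'] := eqVneq j' i; first by rewrite ji' j'i' eqxx in neq.
      by rewrite disjoints1 uB ?lti.
    have [j'i'|j'i'] := eqVneq j' i; last by apply: dB; rewrite ?lti.
    by rewrite disjoint_sym disjoints1 uB ?lti.
  - move=> j /andP[j0 ji]; have pj := par_lt j0.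
    have -> : (par j == i) = false by rewrite ltn_eqF // (leq_trans pj).
    have [ji'|ji'] := eqVneq j i; last by apply: eB; rewrite j0 lti.
    subst j; have [_ rB _] := HB _ pj; have /and3P[_ _ Gru] := eu j0.
    by exists (r (par i)), u; rewrite set11.
  - move=> j ji; rewrite bdA; have [_|ji'] := eqVneq j i.
      by rewrite sub1set !setU11 set11.
    have [BX rB rX] := HB _ (lti _ ji ji'); split => //.
      exact: subset_trans BX (subsetU1 _ _).
    by rewrite inE rX orbT.
exists X', B', r'; split => //; first by apply: bd_large; rewrite // cbX'.
move=> Z X'Z ZU Zs; rewrite ltnNge; apply/negP => bZ.
have := maxX' Z; rewrite /P ZU Zs bZ (subset_trans AX' (proper_sub X'Z)) /=.
by move=> /(_ isT); rewrite leqNgt proper_card.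
Qed.

Lemma small_model_exists :
  exists2 B, tree_model k B &
    exists2 X : {set V}, X \subset U & #|X| < s /\ forall j, j < k -> B j \subset X.
Proof.
have [X [B [r [XU Xs _ _ [mB HB]]]]] := rooted_model_stage (leqnn k).
by exists B => //; exists X => //; split => // j /HB[].
Qed.

End SmallModel.

(** * Trees and minors *)

Section TreeOrder.
Variables (V : finType) (T : sgraph V).
Hypothesis treeT : is_tree T.

Let rin (ts : seq V) := [rel u v | [&& u \in ts, v \in ts & T u v]].

(** A path inside [ts] between two different neighbors of [x] would close a cycle through [x]. *)
Lemma tree_attach_uniq ts x y y' : x \notin ts -> y \in ts -> y' \in ts ->
  connect (rin ts) y y' -> T x y -> T x y' -> y = y'.
Proof.
move=> xts yts y'ts /connectP[p0 pth lst] Txy Txy'.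
case/shortenP: pth lst => p pth up _ lst.
apply/eqP; apply: contraT => neq.
have allp : all [in ts] p.
  elim: p y {lst up neq yts Txy} pth => //= z p IH y /andP[/and3P[_ zts _] /IH ->].
  by rewrite andbT.
have pT : path T y p by apply: sub_path pth => u v /and3P[].
have p0' : p != [::] by apply: contraNneq neq => pE; rewrite lst pE.
case: treeT => _ /(_ [:: x, y & p]); rewrite /= !ltnS lt0n size_eq0 p0'.
move=> /(_ isT); rewrite /ucycleb /= rcons_path Txy pT -lst (adj_sym T y' x) Txy'.
have := up; rewrite /= => ->; rewrite andbT negbK.
rewrite inE; case: eqVneq xts => [->|_ xts /=]; first by rewrite yts.
by move=> xp; case/negP: xts; exact: (allP allp _ xp).
Qed.

(** Otherwise [ts] would be closed under adjacency and contain all vertices of the connected graph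
    [T]. *)
Lemma tree_attach ts : ts != [::] -> size ts < #|V| -> uniq ts ->
  exists x y, [/\ x \notin ts, y \in ts & T x y].
Proof.
case: ts => // y0 ts' _; set ts := y0 :: ts' => sz uts.
have [[_ conT] _] := treeT.
have [/existsP[y /andP[yts /existsP[x /andP[xts Tyx]]]]|noe] :=
  boolP [exists y, (y \in ts) && [exists x, (x \notin ts) && T y x]].
  by exists x, y; rewrite adj_sym.
have cl : closed T [in ts].
  apply: intro_closed; first by apply: sym_connect_sym; exact: adj_sym.
  move=> u v Tuv /= uts1; apply: contraR noe => vts.
  by apply/existsP; exists u; rewrite uts1; apply/existsP; exists v; rewrite vts.
suff : #|V| <= size ts by rewrite leqNgt sz.
rewrite -(card_uniqP uts); apply: subset_leq_card; apply/subsetP => z _.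
by rewrite -(closed_connect cl (conT y0 z)) mem_head.
Qed.

(** The list grows by one attached vertex at a time; it is kept connected because this makes the
    earlier neighbor unique. *)
Lemma tree_list x0 n : n < #|V| -> exists2 ts : seq V,
  [/\ size ts = n.+1, uniq ts & {in ts &, forall x y, connect (rin ts) x y}] &
  forall i, 0 < i < n.+1 -> exists2 j, j < i /\ T (nth x0 ts j) (nth x0 ts i) &
    forall j', j' < i -> T (nth x0 ts j') (nth x0 ts i) -> j' = j.
Proof.
elim: n => [|n IH] nV.
  exists [:: x0]; last by case.
  by split => // x y; rewrite !inE => /eqP-> /eqP->.
have [ts [sz uts cts] Hts] := IH (ltnW nV).
have [||x [y [xts yts Txy]]] := @tree_attach ts _ _ uts.
- by rewrite -size_eq0 sz.
- by rewrite sz.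
exists (rcons ts x).
  split; rewrite ?size_rcons ?sz ?rcons_uniq ?xts //.
  have sub : subrel (connect (rin ts)) (connect (rin (rcons ts x))).
    apply: connect_sub => u v /= /and3P[uts' vts' Tuv]; apply: connect1 => /=.
    by rewrite !mem_rcons !inE uts' vts' Tuv !orbT.
  have rsym : connect_sym (rin (rcons ts x)).
    by apply: sym_connect_sym => u v /=; rewrite adj_sym andbCA.
  have toy z : z \in rcons ts x -> connect (rin (rcons ts x)) z y.
    rewrite mem_rcons inE => /orP[/eqP->|zts]; last exact/sub/cts.
    by apply: connect1; rewrite /= !mem_rcons !inE eqxx yts Txy orbT.
  by move=> u v /toy cu /toy cv; apply: connect_trans cu _; rewrite rsym.
move=> i /andP[i0 iS]; have [->|ni] := eqVneq i n.+1.
  exists (index y ts); first split.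
  - by rewrite -sz index_mem.
  - by rewrite !nth_rcons sz ltnn eqxx -sz index_mem yts nth_index // adj_sym.
  move=> j jn; rewrite !nth_rcons sz jn ltnn eqxx adj_sym => Txj.
  have jts : nth x0 ts j \in ts by rewrite mem_nth // sz.
  by rewrite (tree_attach_uniq xts yts jts (cts _ _ yts jts) Txy Txj) index_uniq ?sz.
have lin : i < n.+1 by lia.
have [|j [ji Tji] uj] := Hts i; first by rewrite i0.
exists j; first by split; rewrite // !nth_rcons sz lin (ltn_trans ji).
move=> j' j'i; rewrite !nth_rcons sz lin (ltn_trans j'i) //; exact: uj.
Qed.

Lemma tree_order : exists (o : nat -> V) (idx : V -> nat) (par : nat -> nat),
  [/\ (forall t, idx t < #|V| /\ o (idx t) = t),
      (forall i, i < #|V| -> idx (o i) = i),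
      (forall i, 0 < i -> par i < i),
      (forall i, 0 < i < #|V| -> T (o (par i)) (o i))
    & (forall i j, i < j < #|V| -> T (o i) (o j) -> i = par j)].
Proof.
have [[V0 _] _] := treeT.
have /card_gt0P[x0 _] := V0.
have [|ts [sz uts _] Hts] := @tree_list x0 #|V|.-1; first by rewrite prednK.
rewrite prednK // in sz Hts.
have allts t : t \in ts.
  have /subset_cardP/(_ (subset_predT _)) -> // : #|ts| = #|V|.
  by rewrite (card_uniqP uts).
pose o := nth x0 ts.
(* The minimum gives [par i < i] for all i > 0, also beyond the vertices of the tree. *)
pose par i := minn i.-1 (find (fun t => T t (o i)) ts).
have parP i j : 0 < i < #|V| -> j < i -> T (o j) (o i) ->
    (forall j', j' < i -> T (o j') (o i) -> j' = j) -> par i = j.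
  move=> /andP[i0 iV] ji Tji uj.
  have hs : has (fun t => T t (o i)) ts by apply/hasP; exists (o j).
  have fj : find (fun t => T t (o i)) ts <= j.
    by rewrite leqNgt; apply/negP => /(before_find x0); rewrite -/(o j) Tji.
  have <- : find (fun t => T t (o i)) ts = j.
    by apply: uj; [lia|exact: (nth_find x0 hs)].
  by rewrite /par; lia.
exists o, (index^~ ts), par; split.
- by move=> t; rewrite -sz index_mem allts /o nth_index.
- by move=> i iV; rewrite index_uniq ?sz.
- by move=> i i0; rewrite /par; lia.
- move=> i iV; have [j [ji Tji] uj] := Hts _ iV.
  by rewrite (parP i j).
- move=> i j /andP[ij jV] Tij; have jV' : 0 < j < #|V| by lia.
  have [l [li Tlj] ul] := Hts _ jV'.
  by rewrite (parP j l) //; exact: ul.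
Qed.

End TreeOrder.

(** * Models of minors *)

Definition model (W : finType) (T : sgraph W) (V : finType) (G : sgraph V)
    (B : W -> {set V}) : Prop :=
  [/\ (forall t t', t != t' -> [disjoint B t & B t']),
      (forall t, connected_set G (B t))
    & (forall t t', T t t' -> exists u v, [/\ u \in B t, v \in B t' & G u v])].

Definition small_model (W : finType) (T : sgraph W) (V : finType) (G : sgraph V)
    (s : nat) (B : W -> {set V}) : Prop :=
  model T G B /\ #|\bigcup_t B t| <= s.

Section MinorModel.

Definition rel_in (V : finType) (G : sgraph V) (S : {set V}) :=
  [rel u v | [&& u \in S, v \in S & G u v]].

(** [g] need be neither injective nor adjacency preserving: edges may become paths, and [S'] may
    have points that are merely linked to the image. This covers deletions and contractions
    alike. *)
Lemma connected_lift (V V' : finType) (G : sgraph V) (G' : sgraph V')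
    (S : {set V}) (S' : {set V'}) (g : V -> V') :
  connected_set G S -> (forall u, u \in S -> g u \in S') ->
  (forall z, z \in S' -> exists2 u, u \in S & connect (rel_in G' S') z (g u)) ->
  (forall u v, u \in S -> v \in S -> G u v ->
     connect (rel_in G' S') (g u) (g v)) ->
  connected_set G' S'.
Proof.
move=> [/set0Pn[x xS] cS] gS Hz He; split.
  by apply/set0Pn; exists (g x); exact: gS.
have rsym : connect_sym (rel_in G' S').
  by apply: sym_connect_sym => u v /=; rewrite adj_sym andbCA.
have lift u v : u \in S -> v \in S -> connect (rel_in G' S') (g u) (g v).
  move=> uS vS; have /connectP[p pth ->] := cS _ _ uS vS.
  elim: p u {uS vS} pth => //= w p IH u /andP[/and3P[uS wS Guw] /IH].
  by apply: connect_trans; exact: He.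
move=> y z /Hz[u uS yu] /Hz[v vS zv].
apply: connect_trans yu _; apply: connect_trans (lift _ _ uS vS) _.
by rewrite rsym.
Qed.

Lemma has_minor_model (W : finType) (H : sgraph W) (V : finType) (G : sgraph V) :
  has_minor H G -> exists B, model H G B.
Proof.
elim=> {V G} [V G [f [g fK gK] fG]|V G x _ [B [dB cB eB]]
             |V G x y Gxy _ [B [dB cB eB]]|V G x y Gxy _ [B [dB cB eB]]].
- exists (fun t => [set g t]); split.
  + by move=> t t' neq; rewrite disjoints1 inE (can_eq gK).
  + by move=> t; exact: connected_set1.
  + by move=> t t' Htt'; exists (g t), (g t'); rewrite !set11 -fG !gK.
- exists (fun t => val @: B t); split.
  + move=> t t' neq; rewrite disjoint_subset; apply/subsetP => _ /imsetP[u uB ->].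
    apply/negP => /imsetP[v vB /val_inj uv].
    by have /pred0P/(_ u) := dB _ _ neq; rewrite /= uB uv vB.
  + move=> t; apply: (@connected_lift _ _ _ _ (B t) _ val) => //.
    * by move=> u uB; exact: imset_f.
    * by move=> _ /imsetP[u uB ->]; exists u.
    * by move=> u v uB vB Guv; apply: connect1; rewrite /= !imset_f.
  + move=> t t' /eB[u [v [uB vB Guv]]].
    by exists (val u), (val v); rewrite !imset_f.
- exists B; split => //.
  + move=> t; apply: (@connected_lift _ _ _ _ (B t) _ id) => //.
    * by move=> z zB; exists z.
    * move=> u v uB vB /andP[Guv _]; apply: connect1.
      by rewrite /= uB vB.
  + by move=> t t' /eB[u [v [uB vB /andP[Guv _]]]]; exists u, v.
- have xy : x != y by apply: contraTneq Gxy => ->; rewrite adj_irr.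
  pose x' : {z : V | z != y} := exist _ x xy.
  (* [insubd] sends [y] to its default [x'], so [p] is the contraction map; the new branch sets are
     preimages under it. *)
  pose p z : {z : V | z != y} := insubd x' z.
  have pval u : p (val u) = u by exact: valKd.
  have py : p y = x' by apply: val_inj; rewrite val_insubd eqxx.
  have pE z : z != y -> val (p z) = z by move=> zy; rewrite val_insubd zy.
  exists (fun t => [set z | p z \in B t]); split.
  + move=> t t' neq; apply/pred0P => z /=; rewrite !inE.
    by have /pred0P/(_ (p z)) := dB _ _ neq.
  + move=> t; set S' := [set z | _].
    have vS u : u \in B t -> val u \in S' by rewrite inE pval.
    have yS u : u \in B t -> val u = x -> y \in S'.
      move=> uB ux; rewrite inE py; suff -> : x' = u by [].
      by apply: val_inj; rewrite ux.
    apply: (@connected_lift _ _ _ _ (B t) _ val) => //.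
    * move=> z zS; exists (p z); first by rewrite inE in zS.
      have [zy|zy] := eqVneq z y; last by rewrite pE.
      apply: connect1; rewrite /rel_in /= zS vS; last by rewrite inE in zS.
      by rewrite zy py adj_sym.
    * move=> u v uB vB /andP[_ /or3P[Guv|/andP[/eqP ux Gyv]|/andP[/eqP vx Guy]]].
      - by apply: connect1; rewrite /= !vS.
      - apply: (@connect_trans _ _ y); apply: connect1; rewrite /= ?vS ?(yS u) //.
        by rewrite ux.
      - apply: (@connect_trans _ _ y); apply: connect1; rewrite /= ?vS ?(yS v) //.
        by rewrite vx adj_sym.
  + move=> t t' /eB[u [v [uB vB]]].
    case/andP=> _ /or3P[Guv|/andP[/eqP ux Gyv]|/andP[/eqP vx Guy]].
    * by exists (val u), (val v); rewrite !inE !pval.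
    * exists y, (val v); rewrite !inE py pval; split => //.
      by suff -> : x' = u by []; apply: val_inj; rewrite ux.
    * exists (val u), y; rewrite !inE py pval; split => //.
      by suff -> : x' = v by []; apply: val_inj; rewrite vx.
Qed.

Lemma model_connect (W : finType) (T : sgraph W) (V : finType) (G : sgraph V) B :
  connected_graph T -> model T G B ->
  forall t t' x y, x \in B t -> y \in B t' -> connect G x y.
Proof.
move=> [_ cT] [_ cB eB] t t' x y xB yB.
have inB s u v : u \in B s -> v \in B s -> connect G u v.
  move=> us vs; have [_ /(_ _ _ us vs)] := cB s.
  by apply: connect_sub => a b /and3P[_ _]; exact: connect1.
have /connectP[p pth t'E] := cT t t'.
elim: p t x xB pth t'E => [|s p IH] t x xB /=.
  by move=> _ t'E; apply: inB xB _; rewrite -t'E.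
case/andP => /eB[u [v [uB vB Guv]]] pth t'E.
apply: connect_trans (inB _ _ _ xB uB) _.
by apply: connect_trans (connect1 Guv) _; exact: IH vB pth t'E.
Qed.

End MinorModel.

(** * Graphs far from minor-freeness *)

Section Partition.
Variables (V : finType) (G : sgraph V) (d : nat).
Hypothesis degG : max_degree_le G d.

Lemma card_edges_from (D : {set V}) :
  #|[set p : V * V | (p.1 \in D) && G p.1 p.2]| <= d * #|D|.
Proof.
rewrite -sum1dep_card -(pair_big_dep [in D] (fun u v => G u v) (fun _ _ => 1)) /=.
rewrite mulnC -sum_nat_const; apply: leq_sum => u _.
by rewrite sum1dep_card cardsE; exact: degG.
Qed.

Definition cut (U S : {set V}) : {set V * V} :=
  [set p | [&& p.1 \in S, p.2 \in U :\: S & G p.1 p.2]].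

Lemma card_cut (U S : {set V}) : S \subset U ->
  #|cut U S| <= d * #|bd [rel u v | [&& u \in U, v \in U & G u v]] S|.
Proof.
move=> SU; apply: leq_trans (card_edges_from _); apply: subset_leq_card.
apply/subsetP => -[u v]; rewrite !inE /= => /and3P[uS /andP[vS vU] Guv].
rewrite Guv andbT; apply/bdP; split => //; exists v => //=.
by rewrite (subsetP SU) // vU.
Qed.

Variables (s k : nat) (par : nat -> nat) (dlt : rat).
Hypothesis par_lt : forall i, 0 < i -> par i < i.
Hypothesis s_gt0 : 0 < s.
Hypothesis d_gt0 : 0 < d.
Hypothesis dlt_gt0 : (0 < dlt)%R.
Hypothesis s_large : (k%:R <= dlt * s%:R)%R.

Definition no_small_model (U : {set V}) : Prop :=
  forall (B : nat -> {set V}) (X : {set V}), X \subset U -> #|X| < s ->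
    (forall j, j < k -> B j \subset X) -> ~ tree_model G par k B.

(** If there were no sparse cut, each nonempty set of at most [s] vertices would have more than
    [dlt] times as many boundary vertices, since each of these has at most [d] edges. With at most
    [k <= dlt * s] boundary vertices it would then have fewer than [s] vertices, and
    [small_model_exists] would apply. *)
Lemma sparse_cut_exists (U : {set V}) : U != set0 -> no_small_model U ->
  exists S : {set V}, [/\ S \subset U, S != set0, #|S| <= s &
    ((#|cut U S|)%:R <= dlt * (d * #|S|)%N%:R)%R].
Proof.
move=> U0 nomod; apply: contrapT => noS.
pose e := [rel u v | [&& u \in U, v \in U & G u v]].
have expn (S : {set V}) : S \subset U -> S != set0 -> #|S| <= s ->
    (dlt * #|S|%:R < (#|bd e S|)%:R)%R.
  move=> SU S0 Ss; rewrite ltNge; apply/negP => le; apply: noS; exists S.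
  split=> //; apply: (@le_trans _ _ (d * #|bd e S|)%N%:R%R).
    by rewrite ler_nat; exact: card_cut.
  by rewrite !natrM mulrCA ler_wpM2l.
have [||B mB [X XU [Xs HB]]] := @small_model_exists V G par par_lt U s k U0.
- move=> S SU S0 Ss; rewrite -(ltr_nat rat); apply: le_lt_trans (expn _ SU S0 Ss).
  by rewrite mulr_ge0 // ltW.
- move=> S SU Ss bk; have [->|S0] := eqVneq S set0.
    by rewrite cards0.
  rewrite -(ltr_nat rat) -(ltr_pM2l dlt_gt0) (lt_le_trans (expn _ SU S0 Ss)) //.
  by rewrite (le_trans _ s_large) // ler_nat.
by apply: (nomod B X).
Qed.

(** Pieces cut off earlier get larger numbers, so an edge between pieces is counted once, at the cut
    that separated its ends. *)
Lemma sparse_partition (U : {set V}) : no_small_model U ->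
  exists f : V -> nat, [/\ (forall v, v \in U -> f v < #|U|),
    (forall i, #|[set v in U | f v == i]| <= s) &
    ((#|[set p : V * V | [&& p.1 \in U, p.2 \in U, G p.1 p.2 & (f p.2 < f p.1)%N]]|)%:R
       <= dlt * (d * #|U|)%N%:R)%R].
Proof.
move: {2}#|U| (leqnn #|U|) => n; elim: n U => [|n IH] U.
  rewrite leqn0 cards_eq0 => /eqP-> _; exists (fun=> 0); split.
  - by move=> v; rewrite inE.
  - by move=> i; rewrite (_ : finset _ = set0) ?cards0 //; apply/setP=> v; rewrite !inE.
  - rewrite (_ : finset _ = set0) ?cards0 ?muln0 ?mulr0 //.
    by apply/setP=> p; rewrite !inE.
move=> Un nomod; have [->|U0] := eqVneq U set0.
  apply: IH; rewrite ?cards0 // => B X; rewrite subset0 => /eqP->.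
  by apply: nomod; rewrite sub0set.
have [S [SU S0 Ss cutS]] := sparse_cut_exists U0 nomod.
have cUS : #|U| = #|U :\: S| + #|S|.
  by rewrite cardsD (setIidPr SU) subnK // subset_leq_card.
have S_gt0 : 0 < #|S| by rewrite card_gt0.
have [||f [fU fs fc]] := IH (U :\: S); first lia.
  by move=> B X XU; apply: nomod; exact: subset_trans XU (subsetDl _ _).
(* The number of remaining vertices exceeds all values of [f] on them. *)
exists (fun v => if v \in S then #|U :\: S| else f v); split.
- move=> v vU; case: ifPn => vS; first lia.
  by have := fU v; rewrite inE vS vU => /(_ isT); lia.
- move=> i; have [iE|iE] := eqVneq i #|U :\: S|.
    apply: leq_trans Ss; apply: subset_leq_card; apply/subsetP => v.
    rewrite inE iE => /andP[vU]; case: ifPn => // vS fE.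
    by have := fU v; rewrite inE vS vU (eqP fE) ltnn => /(_ isT).
  apply: leq_trans (fs i); apply: subset_leq_card; apply/subsetP => v.
  rewrite !inE => /andP[->]; case: ifPn => [_|//].
  by rewrite eq_sym (negbTE iE).
- set C := finset _ in fc.
  apply: (@le_trans _ _ (#|C :|: cut U S|)%:R%R).
    rewrite ler_nat; apply: subset_leq_card; apply/subsetP => -[u v].
    rewrite !inE /= => /and4P[uU -> ->]; rewrite uU !andbT.
    case: (boolP (u \in S)) => uS; case: (boolP (v \in S)) => vS //=.
    + by rewrite ltnn.
    + by move=> lt; have := fU u; rewrite inE uS uU => /(_ isT); lia.
    + by move=> ->.
  apply: (@le_trans _ _ (#|C|%:R + #|cut U S|%:R)%R).
    by rewrite -natrD ler_nat cardsU leq_subr.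
  by rewrite cUS mulnDr natrD mulrDr lerD.
Qed.

End Partition.

(** For [t0] the first vertex in the order, these are the starts at which a trial has a guaranteed
    chance of success. *)
Definition root_set (W : finType) (T : sgraph W) (V : finType) (G : sgraph V)
    (t0 : W) (s : nat) : {set V} :=
  [set v | `[< exists2 B, small_model T G s B & v \in B t0 >]].

Section Far.
Variables (k : nat) (T : sgraph 'I_k) (t0 : 'I_k) (d N s : nat) (eps : rat)
  (G : sgraph 'I_N).
Hypotheses (treeT : is_tree T) (k_gt1 : 1 < k) (d_gt0 : 0 < d)
  (eps_gt0 : (0 < eps)%R) (degG : max_degree_le G d)
  (farG : far_from_minor_free T d eps G)
  (s_large : (2%:R * k%:R <= eps * s%:R)%R).

(** A small model that avoids the root set would have its branch set of [t0] inside the root set. *)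
Lemma no_small_model_root_set par (o : nat -> 'I_k) idx :
  (forall t, idx t < k /\ o (idx t) = t) ->
  (forall i j, i < j < k -> T (o i) (o j) -> i = par j) ->
  no_small_model G s k par (~: root_set T G t0 s).
Proof.
move=> idxP parP B X XU Xs BX [cB dB eB].
have idxk t : idx t < k by have [] := idxP t.
have idxI : injective idx.
  by move=> t t' e; have [_ <-] := idxP t; have [_ <-] := idxP t'; rewrite e.
have mB : model T G (fun t => B (idx t)).
  split; first by move=> t t' neq; apply: dB => //; rewrite (inj_eq idxI).
    by move=> t; exact: cB.
  move=> t t' Ttt'; have [tt'|t't|/idxI tt'] := ltngtP (idx t) (idx t').
  - have [_ ot] := idxP t; have [_ ot'] := idxP t'.
    rewrite (parP (idx t) (idx t')) ?ot ?ot' ?tt' ?idxk //.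
    by apply: eB; rewrite idxk andbT (leq_ltn_trans _ tt').
  - have [_ ot] := idxP t; have [_ ot'] := idxP t'.
    have -> : idx t' = par (idx t) by apply: parP; rewrite ?ot ?ot' ?t't ?idxk // adj_sym.
    have [|u [v [uB vB Guv]]] := eB (idx t).
      by rewrite idxk andbT (leq_ltn_trans _ t't).
    by exists v, u; rewrite adj_sym.
  - by rewrite tt' adj_irr in Ttt'.
have [/set0Pn[v vB] _] := cB _ (idxk t0).
have /(subsetP XU) := subsetP (BX _ (idxk t0)) _ vB.
rewrite !inE => /negP[]; apply/asboolP; exists (fun t => B (idx t)) => //.
split => //; apply: leq_trans (ltnW Xs); apply: subset_leq_card.
by apply/bigcupsP => t _; exact: BX.
Qed.

(** [G'] keeps only the edges inside the pieces of a sparse partition of the complement of [M]. It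
    is free of [T], so more than [eps * d * N] edges were deleted; at most [eps / 2 * d * N] of them
    join two pieces, and at most [d * #|M|] meet [M]. *)
Lemma far_root_set : (eps * N%:R <= 2%:R * (#|root_set T G t0 s|)%:R)%R.
Proof.
set M := root_set T G t0 s.
have [o [idx [par [idxP _ par_lt _ parP]]]] := tree_order treeT.
rewrite card_ord in idxP parP.
have nomod := no_small_model_root_set idxP parP; rewrite -/M in nomod.
have s_gt0 : 0 < s.
  rewrite lt0n; apply/eqP => s0; move: s_large.
  by rewrite s0 mulr0 leNgt mulr_gt0 // ltr0n (ltn_trans _ k_gt1).
have [||f [_ fs fc]] := @sparse_partition _ G d degG s k par (eps / 2%:R)%R
    par_lt s_gt0 d_gt0 _ _ _ nomod.
- by rewrite divr_gt0.
- by move: s_large => {nomod}; lra.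
pose r := [rel u v | [&& u \notin M, v \notin M, f u == f v & G u v]].
have rsym : symmetric r.
  move=> u v; rewrite /= adj_sym (eq_sym (f u)).
  by case: (u \in M); case: (v \in M).
have rirr : irreflexive r by move=> u; rewrite /= adj_irr !andbF.
pose G' := SGraph rsym rirr.
have G'free : minor_free T G'.
  move=> /has_minor_model[B mB].
  have con := model_connect (proj1 treeT) mB.
  case: (mB) => dB cB eB.
  have ne t : exists x, x \in B t by have [/set0Pn] := cB t.
  have cl u v : connect G' u v -> f u = f v.
    case/connectP => p; elim: p u => [|w p IH] u /=; first by move=> _ ->.
    by case/andP => /and4P[_ _ /eqP-> _]; exact: IH.
  (* As k > 1, a vertex of the model is joined in [G'] to a vertex of another branch set; so it lies
     on an edge of [G'], hence outside [M]. *)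
  have inU t x : x \in B t -> x \notin M.
    move=> xB; have [t' tt'] : exists t', t' != t.
      apply/existsP; rewrite -negb_forall; apply/negP => /forallP all_t.
      have : #|'I_k| <= #|[set t]|.
        by apply: subset_leq_card; apply/subsetP => t' _; rewrite inE; apply: all_t.
      by rewrite card_ord cards1 leqNgt k_gt1.
    have [y yB] := ne t'.
    have : x != y.
      apply: contraTneq yB => <-; apply/negP => xB'.
      by have /pred0P/(_ x) := dB _ _ tt'; rewrite /= xB xB'.
    have /connectP[[|w p]] := con _ _ _ _ xB yB; first by move=> _ ->; rewrite eqxx.
    by case/andP => /and4P[].
  have [x xB] := ne t0; case/negP: (inU _ _ xB); rewrite inE; apply/asboolP.
  exists B => //; split; last first.
    apply: leq_trans (fs (f x)); apply: subset_leq_card.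
    apply/bigcupsP => t _; apply/subsetP => y yB; rewrite inE in_setC (inU _ _ yB) /=.
    by rewrite (cl _ _ (con _ _ _ _ xB yB)).
  split => // [t|t t' /eB[u [v [uB vB /and4P[_ _ _ Guv]]]]]; last by exists u, v.
  apply: (@connected_lift _ _ _ _ (B t) _ id) (cB t) _ _ _ => //.
    by move=> z zB; exists z.
  move=> u v uB vB /and4P[_ _ _ Guv]; apply: connect1.
  by rewrite /= uB vB.
have := farG G'free.
set C := finset _ in fc.
pose D := [set p : 'I_N * 'I_N | (p.1 \in M) && G p.1 p.2].
(* Each deleted edge has an orientation in [C], towards the smaller piece number, or in [D],
   starting in [M]. *)
have sub : (edges G :\: edges G') :|: (edges G' :\: edges G) \subset
    [set [set p.1; p.2] | p in C :|: D].
  apply/subsetP => S /setUP[|] /setDP[/imsetP[[u v]]]; rewrite inE /= => + ->.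
    move=> Guv nE; have Gvu : G v u by rewrite adj_sym.
    have inl : (u, v) \in C :|: D ->
        [set u; v] \in [set [set p.1; p.2] | p in C :|: D].
      by move=> inCD; apply/imsetP; exists (u, v).
    have inr : (v, u) \in C :|: D ->
        [set u; v] \in [set [set p.1; p.2] | p in C :|: D].
      by move=> inCD; apply/imsetP; exists (v, u) => //=; rewrite setUC.
    have [uM|uM] := boolP (u \in M).
      by apply: inl; rewrite in_setU [_ \in D]inE /= uM Guv orbT.
    have [vM|vM] := boolP (v \in M).
      by apply: inr; rewrite in_setU [_ \in D]inE /= vM Gvu orbT.
    have [fuv|fvu|fE] := ltngtP (f u) (f v).
    - by apply: inr; rewrite in_setU [_ \in C]inE /= !in_setC uM vM Gvu fuv.
    - by apply: inl; rewrite in_setU [_ \in C]inE /= !in_setC uM vM Guv fvu.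
    - case/negP: nE; apply/imsetP; exists (u, v) => //.
      by rewrite inE /= uM vM fE eqxx.
  case/and4P => _ _ _ Guv /imsetP[]; exists (u, v) => //.
have cD : #|D| <= d * #|M| by exact: card_edges_from.
have cCD : symdiff_size G G' <= #|C| + #|D|.
  rewrite /symdiff_size (leq_trans (subset_leq_card sub)) //.
  by rewrite (leq_trans (leq_imset_card _ _)) // cardsU leq_subr.
have cM : #|~: M| <= N by rewrite -[leqRHS]card_ord max_card.
move: cCD cD cM; rewrite -!(ler_nat rat) natrD !natrM in fc *.
move=> cCD cD cM far.
have h1 : (eps / 2%:R * (d%:R * #|~: M|%:R) <= eps / 2%:R * (d%:R * N%:R))%R.
  by rewrite ler_pM2l ?divr_gt0 // ler_pM2l // ltr0n.
have h2 : (d%:R * (eps * N%:R) <= d%:R * (2%:R * #|M|%:R) :> rat)%R by lra.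
by rewrite ler_pM2l ?ltr0n // in h2.
Qed.

End Far.

Section FarBasics.
Local Open Scope ring_scope.

Lemma far_N_gt0 k (T : sgraph 'I_k) d N eps (G : sgraph 'I_N) :
  is_tree T -> far_from_minor_free T d eps G -> (0 < N)%N.
Proof.
move=> [[k0 _] _] far; rewrite card_ord in k0; rewrite lt0n; apply/eqP => N0.
have /far : minor_free T G.
  move=> /has_minor_model[B [_ /(_ (Ordinal k0)) [/set0Pn[x _]] _]].
  by have := ltn_ord x; rewrite {2}N0.
by rewrite /symdiff_size setDv setU0 cards0 N0 mulr0 ltxx.
Qed.

(** The edgeless graph is free of [T], which has an edge, and differs from [G] in at most [d * N]
    edges. *)
Lemma far_eps_lt1 k (T : sgraph 'I_k) (o : nat -> 'I_k) par d N eps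
    (G : sgraph 'I_N) :
  (0 < d)%N -> (0 < N)%N -> T (o (par 1%N)) (o 1%N) -> max_degree_le G d ->
  far_from_minor_free T d eps G -> eps < 1.
Proof.
move=> d0 N0 T01 degG far.
pose G0 := @SGraph 'I_N (fun _ _ => false) (fun _ _ => erefl) (fun _ => erefl).
have /far : minor_free T G0.
  by move=> /has_minor_model[B [_ _ /(_ _ _ T01) [u [v []]]]].
have edges0 : edges G0 = set0.
  apply/setP => S; rewrite !inE; apply/negP => /imsetP[p].
  by rewrite inE.
rewrite /symdiff_size edges0 setD0 set0D setU0 => lt.
have : (#|edges G| <= d * N)%N.
  rewrite (leq_trans (leq_imset_card _ _)) //.
  have := card_edges_from degG [set: 'I_N]; rewrite cardsT card_ord.
  apply: leq_trans; apply: subset_leq_card; apply/subsetP => p.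
  by rewrite !inE.
rewrite -(ler_nat rat) natrM => le.
have dN : (0 : rat) < d%:R * N%:R by rewrite mulr_gt0 // ltr0n.
by rewrite -(ltr_pM2r dN) mul1r mulrA (lt_le_trans lt).
Qed.

Lemma root_set_single (T : sgraph 'I_1) N (G : sgraph 'I_N) t :
  root_set T G t 1 = [set: 'I_N].
Proof.
apply/setP => v; rewrite !inE; apply/asboolP; exists (fun=> [set v]) => //.
  split; last by rewrite big_ord1 cards1.
  split=> [t1 t2|t1|t1 t2]; rewrite ?(ord1 t1) ?(ord1 t2) ?eqxx ?adj_irr //.
  exact: connected_set1.
by rewrite set11.
Qed.

End FarBasics.

(** * Exploration *)

Lemma uniq_map_inj_in (A B : eqType) (f : A -> B) (s : seq A) :
  uniq (map f s) -> {in s &, injective f}.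
Proof.
elim: s => //= a s IH /andP[fas us] x y; rewrite !inE.
case/orP=> [/eqP->|xs] /orP[/eqP->|ys] // fE; last exact: IH.
- by rewrite fE map_f in fas.
- by rewrite -fE map_f in fas.
Qed.

Section Exploration.
Variables (k N : nat) (T : sgraph 'I_k) (G : sgraph 'I_N)
  (nbr : 'I_N -> seq 'I_N) (o : nat -> 'I_k) (idx : 'I_k -> nat)
  (par : nat -> nat).

(* An explored vertex, its label, and the vertex from which it was reached (for
   the first vertex: itself). *)
Definition entry := ('I_N * 'I_k * 'I_N)%type.
Implicit Types (e : entry) (L : seq entry).
Definition vert e := e.1.1.
Definition lab e := e.1.2.
Definition pred_vert e := e.2.

(* The neighbor number j of entry number i is added to the table, either with
   the same label or, if z holds, with the new label o c. *)
Definition nxt L (c i j : nat) (z : bool) : option (seq entry * nat) :=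
  if onth L i is Some e then
    if onth (nbr (vert e)) j is Some w then
      if w \in map vert L then None
      else if z then
        if lab e == o (par c) then Some (rcons L (w, o c, vert e), c.+1) else None
      else Some (rcons L (w, lab e, vert e), c)
    else None
  else None.

(** The number c counts the labels [o 0], ..., [o (c - 1)] in use; a trial is complete when it
    reaches [k]. *)
Inductive explored : seq entry -> nat -> Prop :=
| Explored_start v : explored [:: (v, o 0, v)] 1
| Explored_next L c i j z L' c' : explored L c -> c < k ->
    nxt L c i j z = Some (L', c') -> explored L' c'.

Hypotheses (treeT : is_tree T)
  (idxP : forall t, idx t < k /\ o (idx t) = t)
  (idxK : forall i, i < k -> idx (o i) = i)
  (par_lt : forall i, 0 < i -> par i < i)
  (parT : forall i, 0 < i < k -> T (o (par i)) (o i))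
  (parP : forall i j, i < j < k -> T (o i) (o j) -> i = par j)
  (nbrG : neighbor_lists G nbr).

Definition bag L t : {set 'I_N} := [set v | (v, t) \in map fst L].

(** The first entry is its own predecessor and yields no edge. *)
Definition tree_edges L : seq ('I_N * 'I_N) :=
  [seq (pred_vert e, vert e) | e <- behead L].

Definition explored_rel L : rel 'I_N := fun u v =>
  (u != v) && (((u, v) \in tree_edges L) || ((v, u) \in tree_edges L)).

Lemma explored_rel_sym L : symmetric (explored_rel L).
Proof. by move=> u v; rewrite /explored_rel eq_sym orbC. Qed.

Lemma explored_rel_irr L : irreflexive (explored_rel L).
Proof. by move=> u; rewrite /explored_rel eqxx. Qed.

Definition explored_graph L := SGraph (@explored_rel_sym L) (@explored_rel_irr L).

Definition explored_inv L c : Prop :=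
  [/\ L != [::] /\ uniq (map vert L), 0 < c <= k,
      (forall e, e \in L -> exists2 i, i < c & lab e = o i),
      (forall u v, (u, v) \in tree_edges L ->
         [&& u \in map vert L, v \in map vert L & G u v])
    & (forall i, i < c -> connected_set (explored_graph L) (bag L (o i))) /\
      (forall i, 0 < i < c -> exists u v,
         [/\ u \in bag L (o (par i)), v \in bag L (o i) & explored_graph L u v])].

Lemma o_inj i j : i < k -> j < k -> o i = o j -> i = j.
Proof. by move=> ik jk oij; rewrite -(idxK ik) -(idxK jk) oij. Qed.

Lemma connected_set_mono (V : finType) (F F' : sgraph V) (S : {set V}) :
  subrel F F' -> connected_set F S -> connected_set F' S.
Proof.
move=> FF' cS; apply: (@connected_lift _ _ _ _ S _ id) cS _ _ _ => //.
  by move=> z zS; exists z.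
by move=> u v uS vS /FF' Fuv; apply: connect1; rewrite /= uS vS.
Qed.

Lemma tree_edges_rcons L e : L != [::] ->
  tree_edges (rcons L e) = rcons (tree_edges L) (pred_vert e, vert e).
Proof. by case: L => // e0 L _; rewrite /tree_edges /= map_rcons. Qed.

Lemma bag_rcons L e t :
  bag (rcons L e) t = if lab e == t then vert e |: bag L t else bag L t.
Proof.
apply/setP => v; rewrite inE map_rcons mem_rcons inE.
case: e => -[w l] p; rewrite /lab /vert /= xpair_eqE.
by rewrite [l == t]eq_sym; case: (t == l); rewrite !inE ?andbT ?andbF.
Qed.

Lemma nxt_Some L c i j z L' c' : nxt L c i j z = Some (L', c') ->
  exists e w, [/\ e \in L, G (vert e) w, w \notin map vert L,
    z -> lab e = o (par c) &
    (L', c') = (rcons L (w, if z then o c else lab e, vert e), z + c)].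
Proof.
rewrite /nxt; case eL : (onth L i) => [e|] //.
have eL' : e \in L by apply/onthP; exists i.
case ew : (onth _ j) => [w|] //; case: ifPn => // wL.
have Gw : G (vert e) w.
  by have [_ <-] := nbrG (vert e); apply/onthP; exists j.
by case: z => [|[<- <-]]; [case: eqP => // le [<- <-]|]; exists e, w.
Qed.

(** A new vertex joins the bag of its predecessor along the edge between them, or opens the bag of
    [o c] next to that of [o (par c)]. *)
Lemma explored_invP L c : explored L c -> explored_inv L c.
Proof.
have [[k0 _] _] := treeT; rewrite card_ord in k0.
elim=> {L c} [v|L c i j z L' c' _ [[L0 uL] cb lb eb [con edg]] ck].
  split=> //.
  - by move=> e; rewrite inE => /eqP ->; exists 0.
  - split=> [[|//] _|[|i] /andP[]//].
    rewrite (_ : bag _ _ = [set v]); first exact: connected_set1.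
    by apply/setP => w; rewrite !inE /= !xpair_eqE eqxx andbT.
case/nxt_Some => e [w [eL Gew wL ze [-> ->]]].
set l := if z then _ else _; set e' := (w, l, vert e).
have c_gt0 : 0 < c by case/andP: cb.
have eV : vert e \in map vert L by exact: map_f.
have sub : subrel (explored_graph L) (explored_graph (rcons L e')).
  move=> u v /= /andP[uv]; rewrite /explored_rel uv tree_edges_rcons //.
  by rewrite !mem_rcons !inE => /orP[]->; rewrite !orbT.
have ew : explored_graph (rcons L e') (vert e) w.
  rewrite /= /explored_rel tree_edges_rcons // mem_rcons inE eqxx andbT.
  by apply: contraNneq wL => <-.
have eB : vert e \in bag L (lab e).
  by rewrite inE; apply/mapP; exists e => //; rewrite /vert /lab; case: (e.1).
have bagS t : bag L t \subset bag (rcons L e') t.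
  by rewrite bag_rcons; case: eqP => // _; exact: subsetU1.
split.
- split; first by rewrite -size_eq0 size_rcons.
  by rewrite map_rcons rcons_uniq wL.
- by case: z {ze l e' sub ew bagS} => /=; lia.
- move=> f; rewrite mem_rcons inE => /orP[/eqP->|/lb[i' i'c ->]].
    rewrite /lab /= /l; case: z {ze l e' sub ew bagS} => /=; first by exists c; rewrite ?add1n.
    by have [i' i'c ->] := lb _ eL; exists i'.
  by exists i' => //; lia.
- move=> u v; rewrite tree_edges_rcons // map_rcons !mem_rcons !inE.
  case/orP=> [|/eb/and3P[-> -> ->]]; last by rewrite !orbT.
  by case/eqP => -> ->; rewrite eqxx eV Gew orbT.
- split=> [i' i'c|i' i'c].
    have old : i' < c -> connected_set (explored_graph (rcons L e')) (bag L (o i')).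
      by move=> /con; exact: connected_set_mono.
    rewrite bag_rcons; case: eqP => [le|nle]; last first.
      apply: old; move: i'c nle; rewrite /lab /= /l; case: (z) => //=.
      by rewrite add1n ltnS leq_eqVlt => /orP[/eqP->|].
    move: le; rewrite /lab /= /l; case zE : z => le.
      (* All labels used before are [o i2] with i2 < c, so the bag of the new label was empty. *)
      have -> : bag L (o i') = set0.
        apply/eqP; apply: contraT => /set0Pn[v]; rewrite inE => /mapP[f fL vf].
        have [i2 i2c] := lb _ fL; rewrite /lab -vf /= -le => oo.
        by have := o_inj ck (ltn_trans i2c ck) oo => cE; rewrite cE ltnn in i2c.
      by rewrite setU0; exact: connected_set1.
    have i'c' : i' < c by move: i'c; rewrite zE.
    have -> : vert e' |: bag L (o i') = bag L (o i') :|: [set vert e; w].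
      apply/setP => v; rewrite !in_setU !in_set1 orbC; case: (boolP (v \in _)) => //= vB.
      suff -> : (v == vert e) = false by [].
      by apply/negbTE; apply: contraNneq vB => ->; rewrite -le.
    apply: (connected_setU (old i'c') (connected_set2 ew) (x := vert e)).
      by rewrite -le.
    by rewrite set21.
  have [ic|ic] := ltnP i' c.
    have [|u [v [uB vB Fuv]]] := edg i'; first by rewrite ic andbT; case/andP: i'c.
    by exists u, v; rewrite !(subsetP (bagS _)) // sub.
  have [zE iE] : z /\ i' = c by move: i'c ic; case: (z) => /=; lia.
  exists (vert e), w; split=> //.
    by apply: (subsetP (bagS _)); rewrite iE -(ze zE).
  by rewrite bag_rcons /lab /= /l zE iE eqxx setU11.
Qed.

Definition output_of L : output := Output
  [seq ((vert e).+1, (lab e).+1) | e <- L]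
  [seq ((pred_vert e).+1, (vert e).+1) | e <- behead L].

Lemma explored_minor L : explored L k -> output_is_minor T G (output_of L).
Proof.
move/explored_invP => [[L0 uL] _ lb eb [con edg]].
have memF u v : (u, v) \in tree_edges L -> u != v.
  by move=> /eb/and3P[_ _]; apply: contraTneq => ->; rewrite adj_irr.
have mem_succ n n' (s : seq ('I_n * 'I_n')) (a : 'I_n) (b : 'I_n') :
    ((a.+1, b.+1) \in [seq ((p.1 : 'I_n).+1, (p.2 : 'I_n').+1) | p <- s]) =
    ((a, b) \in s).
  apply: (mem_map (f := fun p : 'I_n * 'I_n' => (p.1.+1, p.2.+1)) _ s (a, b)).
  by case=> x y [x' y'] /= [/val_inj-> /val_inj->].
have oedges : out_edges (output_of L) =
    [seq ((p.1 : 'I_N).+1, (p.2 : 'I_N).+1) | p <- tree_edges L].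
  by rewrite /= /tree_edges -map_comp.
have overts : out_vertices (output_of L) =
    [seq ((p.1 : 'I_N).+1, (p.2 : 'I_k).+1) | p <- map fst L].
  by rewrite /= -map_comp.
exists [set v | v \in map vert L], (explored_graph L), (bag L); split; split.
- by move=> a l /mapP[e _ [-> ->]]; rewrite /= !ltn_ord.
- by move=> a b /mapP[e _ [-> ->]]; rewrite /= !ltn_ord.
- move=> v; have ordI : injective (fun v : 'I_N => v.+1) by move=> x y [/val_inj].
  rewrite inE -(mem_map ordI) /unzip1 /= -!map_comp.
  by congr (_ \in _); apply: eq_map.
- by move=> t v; rewrite overts mem_succ inE.
- move=> u v; rewrite oedges !mem_succ.
  rewrite /= /explored_rel andb_idl // => /orP[/memF//|/memF].
  by rewrite eq_sym.
- move=> u v /= /andP[_ /orP[]/eb/and3P[]]; rewrite !inE => -> -> //=.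
  by rewrite adj_sym.
- move=> t; apply/subsetP => v; rewrite !inE => /mapP[e eL ve].
  by apply/mapP; exists e => //; rewrite /vert -ve.
- move=> t t' neq; apply/pred0P => v /=; apply/negP => /andP[].
  rewrite !inE => /mapP[e eL ve] /mapP[e' e'L ve'].
  have ee' : e = e'.
    by apply: (uniq_map_inj_in uL) => //; rewrite /vert -ve -ve'.
  by case/eqP: neq; move: ve'; rewrite -ee' -ve => -[].
- by move=> t; have [tk <-] := idxP t; exact: con.
- move=> t t' Ttt'; have [tk ot] := idxP t; have [tk' ot'] := idxP t'.
  have [tt'|t't|tt'] := ltngtP (idx t) (idx t').
  + have := parP (i := idx t) (j := idx t'); rewrite tt' tk' ot ot' => /(_ isT Ttt') pt.
    by have := edg (idx t'); rewrite tk' andbT -pt ot ot'; apply; lia.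
  + have := parP (i := idx t') (j := idx t); rewrite t't tk ot ot' adj_sym.
    move=> /(_ isT Ttt') pt.
    have := edg (idx t); rewrite tk andbT -pt ot ot' => -[|u [v [uB vB Fuv]]]; first lia.
    by exists v, u; rewrite adj_sym.
  + by move: Ttt'; rewrite -ot -ot' tt' adj_irr.
Qed.

Definition consistent (B : 'I_k -> {set 'I_N}) L : Prop :=
  forall e, e \in L -> vert e \in B (lab e).

Lemma consistent_size B L c : explored L c -> consistent B L ->
  size L <= #|\bigcup_t B t|.
Proof.
move=> /explored_invP[[_ uL] _ _ _ _] cB.
rewrite -(size_map vert) -(card_uniqP uL); apply: subset_leq_card.
apply/subsetP => v /mapP[e eL ->]; apply/bigcupP.
by exists (lab e) => //; exact: cB.
Qed.

(** If the bag of [o (par c)] does not yet fill its branch set, connectedness yields an edge from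
    the bag to an unexplored vertex of this branch set. If it does, the edge of the model between
    [o (par c)] and [o c] leads to the first vertex of the next bag. *)
Lemma explored_progress d B L c : max_degree_le G d -> model T G B ->
  explored L c -> c < k -> consistent B L ->
  exists i j z L' c', [/\ i < size L, j < d, nxt L c i j z = Some (L', c'),
    consistent B L' & size L' = (size L).+1].
Proof.
move=> degG [dB cB eB] exL ck consL.
have [[L0 uL] /andP[c0 _] lb eb [con edg]] := explored_invP exL.
have eqB t t' v : v \in B t -> v \in B t' -> t = t'.
  move=> vt vt'; apply/eqP; apply: contraT => neq.
  by have /pred0P/(_ v) := dB _ _ neq; rewrite /= vt vt'.
have bagB t v : v \in bag L t -> v \in B t.
  by rewrite inE => /mapP[e /consL + ve]; rewrite /vert /lab -ve.
have inbag w : w \in map vert L -> exists t, w \in bag L t.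
  move=> /mapP[e eL ->]; exists (lab e); rewrite inE; apply/mapP; exists e => //.
  by rewrite /vert /lab; case: (e.1).
suff [u [w [z [uB Guw wL wB]]]] : exists u w (z : bool),
    [/\ u \in bag L (o (par c)), G u w, w \notin map vert L &
        w \in B (if z then o c else o (par c))].
  move: uB; rewrite inE => /mapP[e eL ue].
  have [ul lu] : vert e = u /\ lab e = o (par c) by rewrite /vert /lab -ue.
  have [unb memb] := nbrG u.
  have wn : w \in nbr u by rewrite memb.
  have /onthP[i eLi] := eL; have /onthP[j wj] := wn.
  exists i, j, z, (rcons L (w, if z then o c else lab e, vert e)), (z + c).
  split.
  - by rewrite ltnNge; apply/negP => /onth_default; rewrite eLi.
  - have jn : j < size (nbr u) by rewrite ltnNge; apply/negP => /onth_default; rewrite wj.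
    apply: leq_trans jn (leq_trans _ (degG u)).
    by rewrite -(card_uniqP unb); apply: subset_leq_card; apply/subsetP => v; rewrite memb.
  - by rewrite /nxt eLi ul wj (negbTE wL) lu eqxx; case: (z).
  - move=> f; rewrite mem_rcons inE => /orP[/eqP->|/consL //].
    by rewrite /vert /lab /= -/(lab e) lu.
  - by rewrite size_rcons.
have [/subsetP full|/subsetPn[x xB xL]] := boolP (B (o (par c)) \subset bag L (o (par c))).
  have [|u [w [uB wB Guw]]] := eB (o (par c)) (o c); first by apply: parT; rewrite c0.
  exists u, w, true; split=> //; first exact: full.
  apply/negP => /inbag[t wt]; have := eqB _ _ _ wB (bagB _ _ wt) => tE.
  move: wt; rewrite inE => /mapP[e eL te]; have [i ic] := lb _ eL.
  rewrite /lab -te -tE => /(o_inj ck (ltn_trans ic ck)) cE.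
  by rewrite cE ltnn in ic.
have [/set0Pn[y yL] _] := con _ (par_lt c0).
have [_ /(_ _ _ (bagB _ _ yL) xB) /connectP[p pth xE]] := cB (o (par c)).
have [u [w [ubag wB wnL Guw]]] : exists u w, [/\ u \in bag L (o (par c)),
    w \in B (o (par c)), w \notin bag L (o (par c)) & G u w].
  elim: p y yL pth xE => [|w p IH] y yL /=; first by move=> _ xE; rewrite xE yL in xL.
  case/andP => /and3P[_ wB Gyw] pth xE.
  by have [/IH|wL] := boolP (w \in bag L (o (par c))); [apply|exists y, w].
exists u, w, false; split=> //; apply/negP => /inbag[t wt].
by case/negP: wnL; rewrite (eqB _ _ _ wB (bagB _ _ wt)).
Qed.

End Exploration.

Arguments vert {k N} e.
Arguments lab {k N} e.
Arguments pred_vert {k N} e.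

(* [Defs] is imported again because the analysis library shadows [eval]. *)
From mathcomp Require Import all_classical all_reals all_analysis.
Require Import Defs.
Import numFieldNormedType.Exports.
Local Open Scope ring_scope.

(** * Expected cost of programs *)

Section Cost.
Variables (R : realType) (N : nat) (nbr : 'I_N -> seq 'I_N) (P : output -> Prop).
Hypothesis N_gt0 : (0 < N)%N.

Definition avg (c : config) (f : config -> R) : R :=
  (\sum_(c' <- step nbr c) f c') / (size (step nbr c))%:R.

Lemma size_step c : (0 < size (step nbr c))%N.
Proof. by case: c => -[|[]] //= *; rewrite size_map size_iota. Qed.

Lemma avg_le c f g : (forall c', f c' <= g c') -> avg c f <= avg c g.
Proof.
by move=> fg; rewrite ler_wpM2r ?invr_ge0 ?ler0n //; exact: ler_sum.
Qed.

Lemma avgD c f g : avg c (fun c' => f c' + g c') = avg c f + avg c g.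
Proof. by rewrite /avg big_split mulrDl. Qed.

Lemma avg_cst c x : avg c (fun=> x) = x.
Proof.
rewrite /avg big_const_seq count_predT iter_addr_0 -[x *+ _]mulr_natr mulfK //.
by rewrite pnatr_eq0 -lt0n size_step.
Qed.

(* The expected number of steps among the first n, plus a penalty Lam for
   halting (before step n) with an output that does not satisfy P. *)
Fixpoint cost (Lam : R) (n : nat) (c : config) : R :=
  if n is n'.+1 then
    if halted c then (if `[< P (out c) >] then 0 else Lam)
    else 1 + avg c (cost Lam n')
  else 0.

Definition halted_before Q n c : R := \sum_(0 <= t < n) halt_prob nbr R Q t c.

Lemma halted_beforeS Q n c : halted_before Q n.+1 c =
  if halted c then (`[< Q (out c) >])%:R else avg c (halted_before Q n).
Proof.
rewrite /halted_before big_nat_recl //=; case: ifPn => hc /=.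
  by rewrite big1 ?addr0 // => t _; rewrite hc.
rewrite add0r /avg /halted_before exchange_big mulr_suml /=.
by apply: eq_bigr => t _.
Qed.

Lemma halted_before_ge0 Q n c : 0 <= halted_before Q n c.
Proof.
elim: n c => [|n IH] c; first by rewrite /halted_before big_geq.
rewrite halted_beforeS; case: ifP => // _.
by rewrite -(avg_cst c 0); exact: avg_le.
Qed.

Lemma halted_before_le1 Q n c : halted_before Q n c <= 1.
Proof.
elim: n c => [|n IH] c; first by rewrite /halted_before big_geq.
rewrite halted_beforeS; case: ifP => _; first by case: asboolP.
by rewrite -[leRHS](avg_cst c 1); exact: avg_le.
Qed.

Lemma halt_prob_ge0 Q t c : 0 <= halt_prob nbr R Q t c.
Proof.
elim: t c => [|t IH] c //=; case: ifP => // _.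
by rewrite divr_ge0 // sumr_ge0.
Qed.

Definition time_before n c : R :=
  \sum_(0 <= t < n) t%:R * halt_prob nbr R (fun=> True) t c.

Lemma time_beforeS n c : time_before n.+1 c =
  if halted c then 0 else
    avg c (fun c' => time_before n c' + halted_before (fun=> True) n c').
Proof.
rewrite /time_before big_nat_recl //= mul0r add0r; case: ifPn => hc /=.
  by rewrite big1 // => t _; rewrite ?hc mulr0.
rewrite /avg /time_before /halted_before.
under [in RHS]eq_bigr => c' _ do rewrite -big_split.
rewrite /= exchange_big mulr_suml; apply: eq_bigr => t _.
rewrite mulrA mulr_sumr; congr (_ / _); apply: eq_bigr => c' _.
by rewrite -natr1 mulrDl mul1r.
Qed.

Lemma time_before_le_cost Lam n c : 0 <= Lam -> time_before n c <= cost Lam n c.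
Proof.
move=> Lam0; elim: n c => [|n IH] c; first by rewrite /time_before big_geq.
rewrite time_beforeS /=; case: ifP => _; first by case: ifP.
rewrite avgD addrC lerD ?avg_le // -[leRHS](avg_cst c 1).
by apply: avg_le => c'; exact: halted_before_le1.
Qed.

(** A run that does not halt with an output in [P] before step n pays [Lam] for another output, or n
    for running on; in the latter case [th] exceeds the payment by at most [th - n]. *)
Lemma not_halted_le_cost Lam n c th : 0 <= Lam -> th <= Lam ->
  th * (1 - halted_before P n c) <= cost Lam n c + Num.max 0 (th - n%:R).
Proof.
move=> Lam0; elim: n c th => [|n IH] c th thL.
  rewrite /halted_before big_geq // subr0 mulr1 add0r subr0.
  by rewrite le_max lexx orbT.
have max0 x : (0 : R) <= Num.max 0 x by rewrite le_max lexx.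
rewrite halted_beforeS /=; case: ifP => _.
  case: asboolP => _ /=; first by rewrite subrr mulr0 add0r max0.
  by rewrite subr0 mulr1 (le_trans thL) // lerDl max0.
rewrite -[X in X - _](avg_cst c 1).
have -> : avg c (fun=> 1) - avg c (halted_before P n) =
    avg c (fun c' => 1 - halted_before P n c').
  by rewrite avgD /avg sumrN mulNr.
have -> : th - n.+1%:R = (th - 1) - n%:R by rewrite -natr1; ring.
set mx := Num.max _ _.
have -> : th * avg c (fun c' => 1 - halted_before P n c') =
    avg c (fun c' => th * (1 - halted_before P n c')).
  by rewrite /avg mulrA mulr_sumr.
rewrite -addrA -(avg_cst c mx) -avgD -[X in X + _](avg_cst c 1) -avgD.
apply: avg_le => c'; have := IH c' (th - 1) _; rewrite -/mx.
have := halted_before_ge0 P n c'; lra.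
Qed.

(** Penalty 0 bounds the expected time. With penalty and threshold n + 1, the probability of not
    halting in [P] before step n is at most (K + 1) / (n + 1), which tends to 0. *)
Lemma cost_sound c K :
  (forall Lam n, 0 <= Lam -> cost Lam n c <= K) ->
  almost_surely_outputs nbr R P c /\ (expected_time nbr R c <= K%:E)%E.
Proof.
move=> costK; split; last first.
  rewrite /expected_time; apply: lime_le.
    by apply: is_cvg_nneseries => t _ _; rewrite lee_fin mulr_ge0 // halt_prob_ge0.
  apply: nearW => n; rewrite sumEFin lee_fin.
  exact: le_trans (time_before_le_cost _ _ (lexx 0)) (costK 0 n _).
rewrite /almost_surely_outputs; apply/cvg_lim => //.
under eq_fun => n do rewrite sumEFin.
apply/cvg_EFin; first by apply: nearW.
rewrite -/(halted_before P ^~ c).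
apply: (squeeze_cvgr (f := fun n => 1 - (K + 1) * harmonic n) (h := fun=> 1)).
- apply: nearW => n; rewrite halted_before_le1 andbT.
  rewrite lerBlDl -lerBlDr ler_pdivlMr // mulrC.
  have := not_halted_le_cost n c (ler0n _ n.+1) (lexx (n.+1%:R : R)).
  rewrite -natr1 addrAC subrr add0r => /le_trans; apply.
  by rewrite lerD ?costK // ge_max ler01 lexx.
- have lim0 : ((K + 1) * harmonic n @[n --> \oo] --> (K + 1) * 0)%classic.
    by apply: cvgM; [exact: cvg_cst|exact: cvg_harmonic].
  have lim1 : (1 - (K + 1) * harmonic n @[n --> \oo] --> 1 - (K + 1) * 0)%classic.
    by apply: cvgB; [exact: cvg_cst|exact: lim0].
  by rewrite mulr0 subr0 in lim1.
- exact: cvg_cst.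
Qed.

(** * Rules for the cost of commands *)

Section Rules.
Variable Lam : R.

(** Quantifying over all horizons up to n makes the bound monotone, as induction over loops
    requires. *)
Definition bounded n s m o (x : R) : Prop :=
  forall n', (n' <= n)%N -> cost Lam n' (Config s m o) <= x.

Lemma bounded_ge0 n s m o x : bounded n s m o x -> 0 <= x.
Proof. by move=> /(_ 0%N (leq0n _)). Qed.

Lemma bounded_le n s m o x y : bounded n s m o x -> x <= y -> bounded n s m o y.
Proof. by move=> b xy n' /b /le_trans; apply. Qed.

Lemma bounded_leq n n' s m o x : bounded n s m o x -> (n' <= n)%N ->
  bounded n' s m o x.
Proof. by move=> b le n2 le2; apply: b; exact: leq_trans le2 le. Qed.

Lemma bounded_nil n m o x : P o -> 0 <= x -> bounded n [::] m o x.
Proof. by move=> Po x0 [|n'] _ //=; rewrite asboolT. Qed.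

Lemma bounded_step1 n x s m o s' m' o' v :
  step nbr (Config (x :: s) m o) = [:: Config s' m' o'] ->
  bounded n s' m' o' (v - 1) -> bounded n.+1 (x :: s) m o v.
Proof.
move=> st b [|n'] le; first by have := bounded_ge0 b => /=; lra.
rewrite /= /avg st big_seq1 divr1; have := b n' le; lra.
Qed.

Lemma bounded_step n x s m o s' m' o' v :
  step nbr (Config (x :: s) m o) = [:: Config s' m' o'] ->
  bounded n s' m' o' (v - 1) -> bounded n (x :: s) m o v.
Proof.
by move=> st b; apply: bounded_leq (leqnSn n); exact: bounded_step1 st b.
Qed.

Lemma bounded_Coin n a s m o v v0 v1 :
  bounded n s (update m (eval m a) 0%N) o v0 ->
  bounded n s (update m (eval m a) 1%N) o v1 ->
  (v0 + v1) / 2 + 1 <= v -> bounded n (Coin a :: s) m o v.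
Proof.
move=> b0 b1 le [|n'] len /=.
  have := bounded_ge0 b0; have := bounded_ge0 b1; lra.
rewrite /avg /= big_cons big_seq1.
have := b0 n' (ltnW len); have := b1 n' (ltnW len); lra.
Qed.

Lemma bounded_RandVertex n a s m o v (f : 'I_N -> R) :
  (forall u : 'I_N, bounded n s (update m (eval m a) u.+1) o (f u)) ->
  (\sum_u f u) / N%:R + 1 <= v -> bounded n (RandVertex a :: s) m o v.
Proof.
move=> b le [|n'] len /=.
  apply: le_trans le; rewrite addr_ge0 // divr_ge0 // sumr_ge0 // => u _.
  exact: bounded_ge0 (b u).
apply: le_trans le; rewrite addrC lerD2r /avg /= size_map size_iota.
rewrite ler_wpM2r ?invr_ge0 // big_map -[1%N]addn0 iotaDl big_map.
rewrite -val_enum_ord big_map big_enum /=.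
by apply: ler_sum => u _; exact: b (ltnW len).
Qed.

(** The invariant carries a potential v. Since the test of the guard takes a step, induction on the
    horizon suffices and termination is not presupposed. *)
Lemma bounded_While (I : memory -> output -> R -> Prop) e x s n :
  (forall m o v, I m o v -> 0 <= v) ->
  (forall n' m o v, (n' <= n)%N ->
     (forall m o v, I m o v -> bounded n' (While e x :: s) m o v) -> I m o v ->
     bounded n' (if eval m e != 0%N then x :: While e x :: s else s) m o (v - 1)) ->
  forall m o v, I m o v -> bounded n (While e x :: s) m o v.
Proof.
move=> I0; elim: n => [|n IH] body m o v Imo.
  by case=> // _; exact: I0 Imo.
apply: bounded_step1; first by rewrite /=.
apply: (body) => // m' o' v'; apply: IH => n2 m2 o2 v2 le2; apply: body.
exact: leqW.
Qed.

End Rules.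
End Cost.

(** * The program *)

(* The program keeps a table whose entries have consecutive indices; a new trial
   starts a new table behind the old one.  Memory layout:
     4 = first index of the table, 5 = index after its last entry,
     6 = index of an entry, 7 = coin, 8 = number of a neighbor, 9 = vertex,
     10 = "new label" coin, 11 = label, 12 = label mismatch, 13 = number of
     labels still to be used, 14 = failure flag, 15 = predecessor;
   arrays (at addresses 16 + i + 4 j): i = 0: vertex, i = 1: label,
   i = 2: predecessor of entry j; i = 3: last index at which vertex j was
   entered, so that j is in the table iff this is at least cell 4. *)
Definition cell (i : nat) : expr := Mem (Const i).
Definition adr (i : nat) (e : expr) : expr :=
  Add (Const (16 + i)) (Add (Add e e) (Add e e)).
Definition arr i e : expr := Mem (adr i e).
Definition adrn (i j : nat) : nat := (16 + i + (j + j + (j + j)))%N.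

Fixpoint muls (t : nat) (e : expr) : expr :=
  if t is t'.+1 then Add e (muls t' e) else Const 0.

Lemma eval_muls m t e : eval m (muls t e) = (t * eval m e)%N.
Proof. by elim: t => //= t ->; rewrite mulSn. Qed.

Definition dist e1 e2 : expr := Add (Sub e1 e2) (Sub e2 e1).

(* 1 - |e - i| is the indicator of e = i, as subtraction is truncated. *)
Fixpoint lookup (f : nat -> nat) (n : nat) (e : expr) : expr :=
  if n is n'.+1 then
    Add (lookup f n' e) (muls (f n') (Sub (Const 1) (dist e (Const n'))))
  else Const 0.

Lemma eval_lookup m f n e :
  eval m (lookup f n e) = if (eval m e < n)%N then f (eval m e) else 0%N.
Proof.
elim: n => //= n IH; rewrite eval_muls /= IH.
have [lt|gt|->] := ltngtP (eval m e) n.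
- by rewrite ltnW // (_ : 1 - _ = 0)%N ?muln0 ?addn0; lia.
- by rewrite ltnNge gt /= (_ : 1 - _ = 0)%N ?muln0 ?addn0; lia.
- by rewrite ltnSn subnn muln1.
Qed.

(** Stores [e] plus j with probability 2^-(j+1), so that no range need be known. *)
Definition guess (a : nat) (e : expr) : cmd :=
  Seq (Store (Const a) e) (Seq (Coin (Const 7)) (While (cell 7)
    (Seq (Store (Const a) (Add (cell a) (Const 1))) (Coin (Const 7))))).

Definition append : cmd :=
  Seq (Store (adr 0 (cell 5)) (cell 9)) (Seq (Store (adr 1 (cell 5)) (cell 11))
  (Seq (Store (adr 2 (cell 5)) (cell 15)) (Seq (Store (adr 3 (cell 9)) (cell 5))
  (Store (Const 5) (Add (cell 5) (Const 1)))))).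

Definition print_table : cmd :=
  Seq (Store (Const 6) (cell 4)) (While (Sub (cell 5) (cell 6))
    (Seq (PrintVertex (arr 0 (cell 6)) (arr 1 (cell 6)))
    (Seq (If (Sub (cell 6) (cell 4)) (PrintEdge (arr 2 (cell 6)) (arr 0 (cell 6))) Skip)
    (Store (Const 6) (Add (cell 6) (Const 1)))))).

Section Program.
Variables (k : nat) (o : nat -> 'I_k) (par : nat -> nat).

Definition choose_label : cmd :=
  let c := Sub (Const k) (cell 13) in
  If (cell 10)
    (Seq (Store (Const 11) (lookup (fun i => (o i).+1) k c))
         (Store (Const 12)
            (dist (arr 1 (cell 6)) (lookup (fun i => (o (par i)).+1) k c))))
    (Seq (Store (Const 11) (arr 1 (cell 6))) (Store (Const 12) (Const 0))).

(** The guard is a sum of three failure tests: label mismatch, no neighbor (name 0), and a vertex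
    already in the table. Failure clears cell 13, which ends the trial, and sets cell 14, which
    starts another. *)
Definition extend : cmd :=
  Seq choose_label
  (If (Add (cell 12) (Add (Sub (Const 1) (cell 9))
         (Sub (Add (arr 3 (cell 9)) (Const 1)) (cell 4))))
    (Seq (Store (Const 13) (Const 0)) (Store (Const 14) (Const 1)))
    (Seq append (Store (Const 13) (Sub (cell 13) (cell 10))))).

Definition round : cmd :=
  Seq (guess 6 (cell 4)) (Seq (guess 8 (Const 1))
  (Seq (Query (Const 9) (arr 0 (cell 6)) (cell 8))
  (Seq (Store (Const 15) (arr 0 (cell 6)))
  (Seq (Coin (Const 10)) extend)))).

Definition trial : cmd :=
  Seq (Store (Const 14) (Const 0)) (Seq (Store (Const 4) (cell 5))
  (Seq (RandVertex (Const 9)) (Seq (Store (Const 15) (cell 9))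
  (Seq (Store (Const 11) (Const (o 0).+1)) (Seq append
  (Seq (Store (Const 13) (Const k.-1)) (While (cell 13) round))))))).

(** Indices start at 1, because 0 in the last array must mean that a vertex was never entered. *)
Definition find_minor : cmd :=
  Seq (Store (Const 5) (Const 1)) (Seq (Store (Const 14) (Const 1))
  (Seq (While (cell 14) trial) print_table)).

End Program.

Ltac bstep := eapply bounded_step; [reflexivity|].

(** * Cost of a guess *)

Section Guess.
Variables (R : realType) (N : nat) (nbr : 'I_N -> seq 'I_N) (P : output -> Prop)
  (Lam : R).
Local Notation bounded := (@bounded R N nbr P Lam).

(** [B] is a reward for the outcome i, which is reached with probability 2^-(i+1). *)
Lemma guess_bounded n s m out a e i (A B : R) : a != 7%N -> 0 <= B <= A ->
  (forall j m', m' a = (eval m e + j)%N ->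
     (forall b, b != a -> b != 7%N -> m' b = m b) ->
     bounded n s m' out (A - (j == i)%:R * B)) ->
  bounded n (guess a e :: s) m out (A + 9 - B / 2 ^+ i.+1).
Proof.
move=> a7 /andP[B0 BA] post.
have a7' : (7 == a) = false by rewrite eq_sym (negbTE a7).
have pw_ge1 j : (1 : R) <= 2 ^+ j by rewrite exprn_ege1 // ler1n.
have Bj j : 0 <= B / 2 ^+ j <= A.
  rewrite divr_ge0 ?exprn_ge0 //= (le_trans _ BA) // ler_pdivrMr ?exprn_gt0 //.
  by rewrite ler_peMr.
(* While the coin shows 1, the outcome i can still be reached only if j < i, with probability
   2^-(i-j). The 9 comes from V = A + 9, the solution of V = 4 + (V + A + 1) / 2. *)
pose I m' out' (v : R) := out' = out /\ exists j, [/\ m' a = (eval m e + j)%N,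
  (forall b, b != a -> b != 7%N -> m' b = m b) &
  (m' 7%N = 0%N /\ v = A - (j == i)%:R * B + 1) \/
  (m' 7%N = 1%N /\ v = A + 9 - (if (j < i)%N then B / 2 ^+ (i - j) else 0))].
have loop : forall m' out' v, I m' out' v -> bounded n (While (cell 7)
    (Seq (Store (Const a) (Add (cell a) (Const 1))) (Coin (Const 7))) :: s) m' out' v.
  apply: bounded_While.
    move=> m' out' v [_ [j [_ _ [[_ ->]|[_ ->]]]]].
      by case: eqP => _; rewrite ?mul1r ?mul0r; lra.
    by case: ifP => _; have := Bj (i - j)%N; lra.
  move=> n' m' _ v len IH [-> [j [ma mb [[m7 ->]|[m7 ->]]]]]; rewrite /= m7 /=.
    by apply: bounded_leq len; apply: bounded_le (post j m' ma mb) _; lra.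
  do 2 bstep.
  set m1 := update _ _ _.
  have m1a : m1 a = (eval m e + j.+1)%N by rewrite /m1 /update /= eqxx ma; lia.
  have m1b b : b != a -> b != 7%N -> m1 b = m b.
    by move=> ba b7; rewrite /m1 /update /= (negbTE ba) mb.
  have upd (y : nat) : update m1 7%N y a = (eval m e + j.+1)%N.
    by rewrite /update (negbTE a7).
  have updb (y : nat) b : b != a -> b != 7%N -> update m1 7%N y b = m b.
    by move=> ba b7; rewrite /update (negbTE b7) m1b.
  apply: (@bounded_Coin _ _ _ _ _ _ _ _ _ _ _ (A - (j.+1 == i)%:R * B + 1)
     (A + 9 - (if (j.+1 < i)%N then B / 2 ^+ (i - j.+1) else 0))).
  - by apply: IH; split=> //; exists j.+1; split; [exact: upd|exact: updb|by left].
  - by apply: IH; split=> //; exists j.+1; split; [exact: upd|exact: updb|by right].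
  have [lt|gt|eq] := ltngtP j.+1 i.
  - have -> : (i - j = (i - j.+1).+1)%N by lia.
    by rewrite exprS mul0r invfM; lra.
  - by rewrite mul0r; lra.
  - have -> : (i - j = 1)%N by lia.
    by rewrite expr1 mul1r; lra.
do 3 bstep.
set m1 := update _ _ _.
have m1a : m1 a = (eval m e + 0)%N by rewrite /m1 /update /= eqxx addn0.
have m1b b : b != a -> b != 7%N -> m1 b = m b.
  by move=> ba b7; rewrite /m1 /update /= (negbTE ba).
have upd (y : nat) : update m1 7%N y a = (eval m e + 0)%N.
  by rewrite /update (negbTE a7).
have updb (y : nat) b : b != a -> b != 7%N -> update m1 7%N y b = m b.
  by move=> ba b7; rewrite /update (negbTE b7) m1b.
apply: (@bounded_Coin _ _ _ _ _ _ _ _ _ _ _ (A - (0 == i)%N%:R * B + 1)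
     (A + 9 - (if (0 < i)%N then B / 2 ^+ (i - 0) else 0))).
- by apply: loop; split=> //; exists 0%N; split; [exact: upd|exact: updb|by left].
- by apply: loop; split=> //; exists 0%N; split; [exact: upd|exact: updb|by right].
case: i {post I loop} => [|i].
  by rewrite eqxx ltnn expr1 mul1r; lra.
by rewrite subn0 mul0r /= [2 ^+ i.+2]exprS invfM; lra.
Qed.

End Guess.

(** * The table in memory *)

Section Table.
Variables k N : nat.
Implicit Types (L : seq (entry k N)) (m : memory).
Local Open Scope nat_scope.

(** The vertex array is 0 behind the table, so a guessed index that is too large makes the query
    return 0 and the trial fail. *)
Definition tabled m b L : Prop :=
  [/\ 0 < b /\ m 4 = b, m 5 = b + size L,
      (forall i e, onth L i = Some e ->
         [/\ m (adrn 0 (b + i)) = (vert e).+1, m (adrn 1 (b + i)) = (lab e).+1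
           & m (adrn 2 (b + i)) = (pred_vert e).+1]),
      (forall j, b + size L <= j -> m (adrn 0 j) = 0)
    & (forall w, (b <= m (adrn 3 w)) = (w \in [seq (vert e).+1 | e <- L]) /\
         m (adrn 3 w) < b + size L)].

(** This is what makes a new table that begins at cell 5 empty, without any clearing of memory. *)
Definition idle m : Prop :=
  [/\ 0 < m 5, (forall j, m 5 <= j -> m (adrn 0 j) = 0)
    & (forall w, m (adrn 3 w) < m 5)].

Lemma tabled_idle m b L : tabled m b L -> idle m.
Proof.
by case=> [[b0 _] m5 _ z st]; split; rewrite m5 ?addn_gt0 ?b0 // => w; case: (st w).
Qed.

Definition same_table m m' : Prop :=
  forall a, (a == 4) || (a == 5) || (16 <= a) -> m' a = m a.

Lemma same_adrn m m' i j : same_table m m' -> m' (adrn i j) = m (adrn i j).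
Proof. by apply; rewrite /adrn; lia. Qed.

Lemma tabled_same m m' b L : same_table m m' -> tabled m b L -> tabled m' b L.
Proof.
move=> mm' [[b0 m4] m5 tab z st]; split; rewrite ?mm' //.
- by move=> i e /tab; rewrite !(same_adrn _ _ mm').
- by move=> j /z; rewrite !(same_adrn _ _ mm').
- by move=> w; rewrite !(same_adrn _ _ mm').
Qed.

Lemma idle_same m m' : same_table m m' -> idle m -> idle m'.
Proof.
move=> mm' [m5 z st]; split; rewrite ?mm' //.
- by move=> j /z; rewrite !(same_adrn _ _ mm').
- by move=> w; rewrite !(same_adrn _ _ mm').
Qed.

Definition append_mem m : memory :=
  update (update (update (update (update m (adrn 0 (m 5)) (m 9))
    (adrn 1 (m 5)) (m 11)) (adrn 2 (m 5)) (m 15)) (adrn 3 (m 9)) (m 5))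
    5 (m 5 + 1).

Lemma append_mem_cell m a : a < 16 -> a != 5 -> append_mem m a = m a.
Proof.
move=> a16 a5; rewrite /append_mem /update (negbTE a5) /adrn.
by do 4 (case: eqP; first lia; move=> _).
Qed.

Lemma append_mem_tabled m b L e : tabled m b L ->
  m 9 = (vert e).+1 -> m 11 = (lab e).+1 -> m 15 = (pred_vert e).+1 ->
  vert e \notin map vert L -> tabled (append_mem m) b (rcons L e).
Proof.
move=> [[b0 m4] m5 tab z st] m9 m11 m15 eL.
have neq5 i j : (adrn i j == 5) = false by rewrite /adrn; lia.
have adrE i j i' j' : i < 4 -> i' < 4 ->
    (adrn i j == adrn i' j') = (i == i') && (j == j').
  by move=> i4 i4'; rewrite /adrn; lia.
split.
- by rewrite append_mem_cell.
- by rewrite /append_mem /update /= size_rcons m5; lia.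
- move=> i f; rewrite -cats1 onth_cat; case: ltnP => iL.
    move=> /tab[t0 t1 t2]; rewrite /append_mem /update !neq5 !adrE //= m5.
    by have -> : (b + i == b + size L) = false by lia.
  case iE : (i - size L) => [|j] /=; last by rewrite onth0n.
  move=> [<-].
  have -> : i = size L by lia.
  by rewrite /append_mem /update !neq5 !adrE //= m5 eqxx m9 m11 m15.
- move=> j; rewrite size_rcons => bj.
  rewrite /append_mem /update !neq5 !adrE //= m5.
  have -> : (j == b + size L) = false by lia.
  by apply: z; lia.
- move=> w; rewrite size_rcons map_rcons mem_rcons inE.
  rewrite /append_mem /update !neq5 !adrE //= m5 m9.
  have [w1 w2] := st w; case: eqP => [->|_] /=; first by rewrite leq_addr; split=> //; lia.
  by rewrite w1; split=> //; lia.
Qed.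

Lemma idle_tabled m : idle m -> m 4 = m 5 -> tabled m (m 5) [::].
Proof.
move=> [m5 z st] m4; split; rewrite ?addn0 //; first by move=> [].
by move=> w; split; rewrite ?addn0 ?st // leqNgt st.
Qed.

End Table.

Section TableCommands.
Variables (R : realType) (k N : nat) (nbr : 'I_N -> seq 'I_N)
  (P : output -> Prop) (Lam : R) (o : nat -> 'I_k) (par : nat -> nat).
Implicit Types (L : seq (entry k N)) (m : memory).
Local Notation bounded := (@bounded R N nbr P Lam).

Lemma append_bounded n s m out v :
  bounded n s (append_mem m) out (v - 9) -> bounded n (append :: s) m out v.
Proof.
move=> H; do 9 bstep; apply: bounded_le H _; lra.
Qed.

Lemma print_table_bounded n m b L :
  tabled m b L -> P (output_of L) ->
  bounded n [:: print_table] m (Output [::] [::]) (8 * (size L)%:R + 3).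
Proof.
move=> tab PL; do 2 bstep; set m0 := update _ _ _.
have m0s : same_table m m0 by move=> a ha; rewrite /m0 /update /=; case: eqP => //; lia.
have [[b0 m4] _ _ _ _] := tab.
have {}tab := tabled_same m0s tab.
have m06 : m0 6%N = b by rewrite /m0 /update /= m4.
clearbody m0; clear m0s m4.
pose I m' out' (v : R) := exists i, [/\ (i <= size L)%N, tabled m' b L,
  m' 6%N = (b + i)%N, out' = Output
    [seq ((vert e).+1, (lab e).+1) | e <- take i L]
    [seq ((pred_vert e).+1, (vert e).+1) | e <- behead (take i L)]
  & v = 8 * (size L - i)%:R + 1].
apply: (@bounded_While _ _ _ _ _ I); last first.
- exists 0%N; rewrite addn0 take0 subn0; split=> //; lra.
- move=> n' m' _ _ _ IH [i [iL tab' m6 -> ->]].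
  have [[_ m4] m5 ent _ _] := tab'.
  rewrite /= m5 m6 subnDl; case: (ltnP i (size L)) => [lt|ge]; last first.
    have iE : i = size L by lia.
    rewrite iE subnn /=; apply: bounded_nil; last by rewrite mulr0 add0r subrr.
    by rewrite take_size -/(output_of L).
  have -> : (size L - i != 0)%N by lia.
  have [e eL] : exists e, onth L i = Some e.
    by case eE : (onth L i) (onthTE L i) => [e|]; [exists e|rewrite lt].
  have [t0 t1 t2] := ent _ _ eL.
  have tk : take i.+1 L = rcons (take i L) e.
    by rewrite (take_nth e lt); congr rcons; exact: onth_nth eL.
  have nextI out' : out' = Output
      [seq ((vert e).+1, (lab e).+1) | e <- take i.+1 L]
      [seq ((pred_vert e).+1, (vert e).+1) | e <- behead (take i.+1 L)] ->
      bounded n' [:: While (Sub (cell 5) (cell 6))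
        (Seq (PrintVertex (arr 0 (cell 6)) (arr 1 (cell 6)))
        (Seq (If (Sub (cell 6) (cell 4)) (PrintEdge (arr 2 (cell 6)) (arr 0 (cell 6))) Skip)
        (Store (Const 6) (Add (cell 6) (Const 1)))))]
      (update m' 6%N (m' 6%N + 1)%N) out' (8 * (size L - i.+1)%:R + 1).
    move=> ->; apply: IH; exists i.+1; split=> //.
    by rewrite /update /= m6; lia.
  have sz : (size L - i)%:R = (size L - i.+1)%:R + 1 :> R.
    by rewrite natr1; congr _%:R; lia.
  do 4 bstep; rewrite /= m6 m4 !addKn -!/(adrn _ _) t0 t1.
  case: i m6 {iL lt} eL t0 t1 t2 tk nextI sz => [|i] m6 eL t0 t1 t2 tk nextI sz /=.
    do 2 bstep; apply: bounded_le (nextI _ _) _; last by rewrite sz; lra.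
    by rewrite tk take0.
  do 2 bstep; apply: bounded_le (nextI _ _) _; last by rewrite sz; lra.
  rewrite /= m6 -!/(adrn _ _) t2 t0 tk !map_rcons; congr Output.
  by case: (L) eL => // e0 L' _ /=; rewrite map_rcons.
- by move=> m' out' v [i [_ _ _ _ ->]]; rewrite addr_ge0 // mulr_ge0.
Qed.

End TableCommands.

(** * Cost of one extension *)

Section Rounds.
Variables (R : realType) (k N : nat) (nbr : 'I_N -> seq 'I_N)
  (P : output -> Prop) (Lam : R) (o : nat -> 'I_k) (par : nat -> nat).
Implicit Types (L : seq (entry k N)) (m : memory).
Local Notation bounded := (@bounded R N nbr P Lam).
Local Notation nxt := (nxt nbr o par).

Lemma answer_nbr (u : 'I_N) j :
  answer nbr u.+1 j.+1 = if onth (nbr u) j is Some w then w.+1 else 0%N.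
Proof.
rewrite /answer valK; case E : (onth _ j) => [w|].
  have jn : (j < size (nbr u))%N by rewrite -onthTE E.
  by rewrite (nth_map u) //; congr S; congr val; exact: onth_nth E.
by rewrite nth_default // size_map -onthNE E.
Qed.

(** A successful extension takes 17 steps: 5 for the label, 9 for [append], 3 for the rest. Failure
    takes fewer. *)
Lemma extend_bounded n s m out b L c i j (z : bool) v :
  tabled m b L -> m 6%N = (b + i)%N ->
  m 9%N = answer nbr (m (adrn 0 (b + i))) j.+1 -> m 15%N = m (adrn 0 (b + i)) ->
  m 10%N = z -> m 13%N = (k - c)%N -> m 14%N = 0%N -> (c < k)%N ->
  match nxt L c i j z with
  | None => forall m', idle m' -> m' 13%N = 0%N -> m' 14%N = 1%N ->
              bounded n s m' out (v - 17)
  | Some (L', c') => forall m', tabled m' b L' -> m' 13%N = (k - c')%N ->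
              m' 14%N = 0%N -> bounded n s m' out (v - 17)
  end -> bounded n (extend o par :: s) m out v.
Proof.
move=> tab m6 m9 m15 m10 m13 m14 ck post.
have [[b0 m4] m5 ent zer st] := tab.
pose l := if z then (o c).+1 else m (adrn 1 (b + i)).
pose er := if z then
    (m (adrn 1 (b + i)) - (o (par c)).+1 + ((o (par c)).+1 - m (adrn 1 (b + i))))%N
  else 0%N.
pose m1 := update (update m 11 l) 12 er.
rewrite /extend; set cnd := Add (cell 12) _; set tail := If _ _ _.
suff main : bounded n (tail :: s) m1 out (v - 5).
  move: main; rewrite /m1 /l /er; case: z m10 {post l er m1} => m10 main.
    do 2 bstep; rewrite /= m10; do 3 bstep.
    have e13 : eval m (Sub (Const k) (cell 13)) = c by rewrite /= m13 subKn // ltnW.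
    have e13' x : eval (update m 11 x) (Sub (Const k) (cell 13)) = c.
      exact: e13.
    rewrite /= !eval_lookup e13 e13' ck /update /= m6.
    by apply: bounded_le main _; lra.
  do 2 bstep; rewrite /= m10; do 3 bstep.
  rewrite /= m6; apply: bounded_le main _; lra.
have m1s : same_table m m1.
  by move=> a ha; rewrite /m1 /update; do 2 (case: eqP => [?|_]; first lia).
have condE : eval m1 cnd = (er + ((1 - m 9%N) + (m (adrn 3 (m 9%N)) + 1 - b)))%N.
  by rewrite -m4.
have fail : (er + ((1 - m 9%N) + (m (adrn 3 (m 9%N)) + 1 - b)) != 0)%N ->
    (forall m', idle m' -> m' 13%N = 0%N -> m' 14%N = 1%N ->
              bounded n s m' out (v - 17)) ->
    bounded n (tail :: s) m1 out (v - 5).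
  move=> cond post'; bstep; rewrite condE cond.
  do 3 bstep; rewrite /=.
  set m2 := update _ _ _.
  have m2s : same_table m1 m2.
    by move=> a ha; rewrite /m2 /update; do 2 (case: eqP => [?|_]; first lia).
  apply: (bounded_le (post' _ _ _ _)) => //; last lra.
  apply: idle_same m2s _; apply: idle_same m1s _; exact: tabled_idle tab.
have ok : (er + ((1 - m 9%N) + (m (adrn 3 (m 9%N)) + 1 - b)) = 0)%N ->
    bounded n s (update (append_mem m1) 13 (m1 13%N - m1 10%N)%N) out (v - 17) ->
    bounded n (tail :: s) m1 out (v - 5).
  move=> cond post'; bstep; rewrite condE cond /=.
  bstep; apply: append_bounded; bstep; rewrite /= !append_mem_cell //.
  by apply: bounded_le post' _; lra.
have tab1 : tabled m1 b L by exact: tabled_same m1s tab.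
move: post; rewrite /Submission.nxt; case eL : (onth L i) => [e|]; last first.
  apply: fail; rewrite m9 zer //; first by rewrite addnCA addn_eq0.
  by rewrite leq_add2l -onthNE eL.
have [t0 t1 t2] := ent _ _ eL.
move: m9; rewrite t0 answer_nbr; case ew : (onth _ j) => [w|] m9; last first.
  by apply: fail; rewrite m9 addnCA.
have [stw ltw] := st w.+1.
have memw : (w.+1 \in [seq (vert e).+1 | e <- L]) = (w \in map vert L).
  have sI : injective (fun v : 'I_N => v.+1) by move=> x y [/val_inj].
  by rewrite -(mem_map sI) -map_comp.
rewrite memw in stw; case: ifPn stw => wL stw.
  by apply: fail; rewrite m9; lia.
have stw0 : (m (adrn 3 w.+1) + 1 - b = 0)%N by lia.
have nextP (t : 'I_k) c' : l = t.+1 -> (k - c - z = k - c')%N ->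
    (forall m', tabled m' b (rcons L (w, t, vert e)) -> m' 13%N = (k - c')%N ->
       m' 14%N = 0%N -> bounded n s m' out (v - 17)) ->
    bounded n s (update (append_mem m1) 13 (m1 13%N - m1 10%N)%N) out (v - 17).
  move=> lt c'E; apply.
  - apply: (@tabled_same _ _ (append_mem m1)).
      by move=> a ha; rewrite /update; case: eqP => [?|_]; [lia|].
    by apply: append_mem_tabled => //; rewrite /m1 /update /= ?m9 ?m15 ?t0 ?lt.
  - by rewrite -c'E -m13 -m10.
  - exact: (etrans (@append_mem_cell m1 14 isT isT) m14).
case zE : z.
  case: eqP => le post.
    apply: ok; first by rewrite m9 stw0 /er zE t1 le subnn.
    by apply: (nextP (o c) c.+1) post; [rewrite /l zE|rewrite zE; lia].
  apply: fail => //; rewrite /er zE t1; apply: contra_notN le => /eqP er0.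
  by apply: val_inj => /=; lia.
move=> post; apply: ok; first by rewrite m9 stw0 /er zE.
by apply: (nextP (lab e) c) post; [rewrite /l zE|rewrite zE; lia].
Qed.

End Rounds.

(** * Expected time of the trials *)

Section ExpectedTime.
Variables (R : realType) (k N d s : nat) (T : sgraph 'I_k) (G : sgraph 'I_N)
  (nbr : 'I_N -> seq 'I_N) (o : nat -> 'I_k) (idx : 'I_k -> nat)
  (par : nat -> nat) (K : R).
Hypotheses (treeT : is_tree T)
  (idxP : forall t, (idx t < k)%N /\ o (idx t) = t)
  (idxK : forall i, (i < k)%N -> idx (o i) = i)
  (par_lt : forall i, (0 < i)%N -> (par i < i)%N)
  (parT : forall i, (0 < i < k)%N -> T (o (par i)) (o i))
  (parP : forall i j, (i < j < k)%N -> T (o i) (o j) -> i = par j)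
  (nbrG : neighbor_lists G nbr) (degG : max_degree_le G d)
  (N_gt0 : (0 < N)%N) (K_ge0 : 0 <= K).
Implicit Types (L : seq (entry k N)) (m : memory).
Local Notation nxt := (nxt nbr o par).
Local Notation explored := (explored nbr o par).

(** Right guesses of i < s, of j < d and of the coin have probability 2^-(i+j+3), which is at least
    this number. *)
Definition guess_prob : R := 2 ^- (s + d + 3).

(* A lower bound for the probability that a trial that has reached the table L
   succeeds. *)
Definition success L : R :=
  if `[< exists2 B, small_model T G s B & consistent B L >]
  then guess_prob ^+ (s - size L) else 0.

Lemma guess_prob_gt0 : 0 < guess_prob.
Proof. by rewrite invr_gt0 exprn_gt0. Qed.

Lemma guess_prob_le1 : guess_prob <= 1.
Proof. by rewrite invf_le1 ?exprn_gt0 // exprn_ege1 // ler1n. Qed.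

Lemma success_itv L : 0 <= success L <= 1.
Proof.
rewrite /success; case: ifP => _; last by rewrite lexx ler01.
rewrite exprn_ge0 ?(ltW guess_prob_gt0) //= exprn_ile1 //.
  exact: ltW guess_prob_gt0.
exact: guess_prob_le1.
Qed.

(** [B] is the reward for the right guess: [K] times the success bound of the next table, or 0 if no
    small model is consistent with [L]. *)
Lemma good_guess L c : explored L c -> (c < k)%N ->
  exists i j z (B : R), [/\ 0 <= B <= K, K * success L <= B / 2 ^+ (i + j + 3),
    (forall L' c', nxt L c i j z = Some (L', c') -> B <= K * success L') &
    (nxt L c i j z = None -> B = 0)].
Proof.
move=> exL ck; rewrite {1}/success; case: asboolP => [[B [mB sB] cB]|_]; last first.
  by exists 0%N, 0%N, false, 0; rewrite lexx K_ge0 mulr0 mul0r; split => // L' c' _;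
    rewrite mulr_ge0 //; case/andP: (success_itv L').
have [i [j [z [L' [c' [iL jd nx cB' sz]]]]]] :=
  explored_progress treeT idxK par_lt parT nbrG degG mB exL ck cB.
have exL' : explored L' c' by exact: Explored_next exL ck nx.
have := leq_trans (consistent_size treeT idxK nbrG exL' cB') sB.
rewrite sz => Ls; have sE : (s - size L = (s - size L').+1)%N by lia.
have sL' : success L' = guess_prob ^+ (s - size L').
  by rewrite /success asboolT //; exists B.
have := success_itv L'; rewrite sL' => /andP[s0 s1].
exists i, j, z, (K * guess_prob ^+ (s - size L')); split.
- by rewrite mulr_ge0 //= ler_piMr.
- rewrite sE exprSr mulrA ler_wpM2l ?mulr_ge0 // /guess_prob.
  rewrite lef_pV2 ?posrE ?exprn_gt0 // ler_weXn2l ?ler1n //; lia.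
- by move=> L2 c2; rewrite nx => -[<- _]; rewrite sL'.
- by rewrite nx.
Qed.

Section Loops.
Variables (P : output -> Prop) (Lam : R).
Local Notation bounded := (@bounded R N nbr P Lam).
Local Notation no_output := (Output [::] [::]).

(** The first term pays for new trials after a failure, and 10 per entry for printing. In half of
    the rounds the coin asks for a new label, and then c grows or the trial ends; so the third term
    releases 60 per round on average, enough for the round and its new entry. *)
Definition potential L c : R :=
  K * (1 - success L) + 10 * (size L)%:R + 120 * (k - c)%N%:R + 20.

Lemma potential_ge L c : 10 * (size L)%:R + 20 <= potential L c.
Proof.
rewrite /potential; have /andP[_ s1] := success_itv L.
have : 0 <= K * (1 - success L) by rewrite mulr_ge0 // subr_ge0.
have : (0 : R) <= (k - c)%N%:R by [].
lra.
Qed.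

Definition running m out v : Prop := out = no_output /\
  ((exists b L c, [/\ explored L c, tabled m b L, m 13%N = (k - c)%N, m 14%N = 0%N
                    & v = potential L c]) \/
   [/\ idle m, m 13%N = 0%N, m 14%N = 1%N & v = K + 1]).

Definition finished m out v : Prop := out = no_output /\
  ((exists b L, [/\ explored L k, tabled m b L, m 14%N = 0%N
                    & v = 8 * (size L)%:R + 5]) \/
   [/\ idle m, m 14%N = 1%N & v = K]).

Lemma round_bounded n stk m b L c :
  explored L c -> tabled m b L -> m 13%N = (k - c)%N -> m 14%N = 0%N -> (c < k)%N ->
  (forall m' v, running m' no_output v -> bounded n stk m' no_output v) ->
  bounded n (round o par :: stk) m no_output (potential L c - 1).
Proof.
move=> exL tab m13 m14 ck post.
have [i0 [j0 [z0 [B [B_itv sucL Bnext Bnone]]]]] := good_guess exL ck.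
have [B0 BK] := andP B_itv.
have kc1 : (1 : R) <= (k - c)%N%:R by rewrite ler1n; lia.
(* The potential without its success term, with one more entry and the 17 steps of [extend]. *)
pose X : R := K + 10 * (size L).+1%:R + 120 * (k - c)%N%:R + 37.
have XB : K + 167 <= X.
  by rewrite /X -natr1; have : (0 : R) <= (size L)%:R by []; lra.
have ext m' i j (z : bool) : tabled m' b L -> m' 6%N = (b + i)%N ->
    m' 9%N = answer nbr (m' (adrn 0 (b + i))) j.+1 ->
    m' 15%N = m' (adrn 0 (b + i)) -> m' 10%N = z -> m' 13%N = (k - c)%N ->
    m' 14%N = 0%N -> bounded n (extend o par :: stk) m' no_output
      (X - 120 * z%:R - [&& i == i0, j == j0 & z == z0]%:R * B).
  move=> tab' m6 m9 m15 m10 m13' m14'.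
  apply: (extend_bounded tab' m6 m9 m15 m10 m13' m14' ck).
  case nE : (nxt L c i j z) => [[L' c']|].
    have [e [w [_ _ _ _ [L'E c'E]]]] := nxt_Some nbrG nE.
    have exL' : explored L' c' by exact: Explored_next exL ck nE.
    move=> m2 tab2 m2_13 m2_14; apply: bounded_le.
      by apply: post; split=> //; left; exists b, L', c'; split.
    have Bs : [&& i == i0, j == j0 & z == z0]%:R * B <= K * success L'.
      case: and3P => [[/eqP ii /eqP jj /eqP zz]|_] /=; last first.
        by rewrite mul0r mulr_ge0 //; case/andP: (success_itv L').
      by rewrite mul1r; apply: Bnext; rewrite -ii -jj -zz nE.
    have -> : potential L' c' = K * (1 - success L') + 10 * (size L).+1%:R +
        120 * ((k - c)%N%:R - z%:R) + 20.
      rewrite /potential L'E size_rcons c'E -natrB; last by case: (z); rewrite ?subn_gt0.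
      by congr (_ + 120 * _%:R + _); case: (z) => /=; lia.
    by move: Bs; rewrite /X; lra.
  move=> m2 idl m2_13 m2_14; apply: bounded_le.
    by apply: post; split=> //; right; split.
  have -> : [&& i == i0, j == j0 & z == z0]%:R * B = 0.
    case: and3P => [[/eqP ii /eqP jj /eqP zz]|_] /=; last by rewrite mul0r.
    by rewrite Bnone ?mulr0 // -ii -jj -zz.
  have : z%:R <= (1 : R) by rewrite lern1 leq_b1.
  by move: XB; lra.
have pw_ge1 j : (1 : R) <= 2 ^+ j by rewrite exprn_ege1 // ler1n.
have sub1 (x y : R) : 0 <= x <= y -> forall j, 0 <= x / 2 ^+ j <= y.
  move=> /andP[x0 xy] j; rewrite divr_ge0 ?exprn_ge0 //= (le_trans _ xy) //.
  by rewrite ler_pdivrMr ?exprn_gt0 // ler_peMr.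
have [[_ m4] _ _ _ _] := tab.
bstep; apply: bounded_le.
  (* Before each guess only the expected part of the reward counts. The 44 is the 60 released by the
     coin, less 6 steps up to the coin, 9 for the second guess and 1 for sequencing. *)
  apply: (@guess_bounded _ _ _ _ _ _ _ _ _ _ _ i0 (X - 44) (B / 2 / 2 ^+ j0.+1)) => //.
    by apply: sub1; lra.
  move=> i m1 m1_6 m1f; bstep; apply: bounded_le.
    apply: (@guess_bounded _ _ _ _ _ _ _ _ _ _ _ j0 (X - 54)
      ((i == i0)%:R * (B / 2))) => //.
      by case: eqP => _; rewrite ?mul1r ?mul0r; lra.
    move=> j m2 m2_8 m2f; do 5 bstep; set m3 := update _ _ _.
    have m2E a : a != 6%N -> a != 7%N -> a != 8%N -> m2 a = m a.
      by move=> a6 a7 a8; rewrite m2f // m1f.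
    have m2_6 : m2 6%N = (b + i)%N by rewrite m2f // m1_6 /= m4.
    have m2A a : m2 (adrn a (b + i)) = m (adrn a (b + i)).
      by rewrite m2E // /adrn; lia.
    have m3s y : same_table m (update m3 10 y).
      move=> a ha; rewrite /m3 /update /=.
      by do 3 (case: eqP => [?|_]; first lia); rewrite m2E //; lia.
    have m3P y : [/\ tabled (update m3 10 y) b L, update m3 10 y 6%N = (b + i)%N,
        update m3 10 y 9%N =
          answer nbr (update m3 10 y (adrn 0 (b + i))) j.+1 &
        update m3 10 y 15%N = update m3 10 y (adrn 0 (b + i))].
      split; [exact: tabled_same (m3s y) tab|exact: m2_6| |];
        rewrite (same_adrn _ _ (m3s y)) -m2A -m2_6; [|by []].
      by rewrite -[j.+1]add1n -[(1 + j)%N]m2_8.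
    have m3_13 y : update m3 10 y 13%N = (k - c)%N by rewrite -m13 -m2E.
    have m3_14 y : update m3 10 y 14%N = 0%N by rewrite -[RHS]m14 -m2E.
    apply: (@bounded_Coin _ _ _ _ _ _ _ _ _ _ _
      (X - 120 * false%:R - [&& i == i0, j == j0 & false == z0]%:R * B)
      (X - 120 * true%:R - [&& i == i0, j == j0 & true == z0]%:R * B)).
    - by have [? ? ? ?] := m3P 0%N; apply: (ext _ i j false).
    - by have [? ? ? ?] := m3P 1%N; apply: (ext _ i j true).
    - case: (i == i0); case: (j == j0); case: (z0) => /=;
        rewrite ?mul0r ?mul1r; lra.
  rewrite mulrAC exprS invfM.
  case: (i == i0); rewrite ?mul0r ?mul1r; lra.
move: sucL; rewrite /potential /X -natr1.
have -> : B / 2 / 2 ^+ j0.+1 / 2 ^+ i0.+1 = B / 2 ^+ (i0 + j0 + 3).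
  rewrite -!mulrA; congr (B * _); rewrite -!invfM -exprD -exprS; congr (_ ^- _); lia.
lra.
Qed.

Lemma potential_ge0 L c : 0 <= potential L c.
Proof.
have := potential_ge L c; have : (0 : R) <= (size L)%:R by []; lra.
Qed.

Lemma rounds_bounded n stk :
  (forall m v, finished m no_output v -> bounded n stk m no_output v) ->
  forall m out v, running m out v ->
  bounded n (While (cell 13) (round o par) :: stk) m out v.
Proof.
move=> post; apply: bounded_While.
  move=> m out v [_ [[b [L [c [_ _ _ _ ->]]]]|[_ _ _ ->]]]; last by rewrite addr_ge0.
  exact: potential_ge0.
move=> n' m out v len IH [-> run] /=.
have IH' m' v' : running m' no_output v' ->
    bounded n' (While (cell 13) (round o par) :: stk) m' no_output v'.
  exact: IH.
have post' m' v' : finished m' no_output v' -> bounded n' stk m' no_output v'.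
  by move=> fin; apply: bounded_leq len; exact: post.
case: run => [[b [L [c [exL tab m13 m14 ->]]]]|[idl m13 m14 ->]]; last first.
  by rewrite m13 /=; apply: post'; split=> //; right; split=> //; rewrite addrK.
have [_ /andP[_ ck] _ _ _] := explored_invP treeT idxK nbrG exL.
rewrite m13; case: (ltnP c k) => [lt|ge].
  have -> : (k - c != 0)%N by rewrite -lt0n subn_gt0.
  exact: round_bounded exL tab m13 m14 lt IH'.
have cE : c = k by apply/eqP; rewrite eqn_leq ck.
subst c; rewrite subnn /=; apply: bounded_le.
  by apply: post'; split=> //; left; exists b, L; split.
have := potential_ge L k; have : (0 : R) <= (size L)%:R by []; lra.
Qed.

Hypothesis K_large :
  120 * k%:R * N%:R <= K * guess_prob ^+ s.-1 * #|root_set T G (o 0) s|%:R.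

Lemma success_start (u : 'I_N) : u \in root_set T G (o 0) s ->
  success [:: (u, o 0, u)] = guess_prob ^+ s.-1.
Proof.
rewrite inE => /asboolP[B smB uB]; rewrite /success asboolT /= ?subn1 //.
by exists B => // e; rewrite inE => /eqP->.
Qed.

(** By [K_large], the average of [K * success] over all starts is at least [120 * k], which
    outweighs the label term and the constants. The 16 counts the steps between the random start and
    the loop. *)
Lemma average_potential :
  (\sum_u (potential [:: (u, o 0, u)] 1 + 16)) / N%:R <= K - 7.
Proof.
have [[k0 _] _] := treeT; rewrite card_ord in k0.
have N0 : (0 : R) < N%:R by rewrite ltr0n.
rewrite ler_pdivrMr //.
have -> : \sum_(u < N) (potential [:: (u, o 0, u)] 1 + 16) =
    (K + 10 + 120 * (k - 1)%N%:R + 36) * N%:R -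
    K * \sum_(u < N) success [:: (u, o 0, u)].
  rewrite mulr_sumr mulr_natr -[in X in X - _](card_ord N) -sumr_const -sumrB.
  by apply: eq_bigr => u _; rewrite /potential /=; ring.
have : K * guess_prob ^+ s.-1 * #|root_set T G (o 0) s|%:R <=
    K * \sum_(u < N) success [:: (u, o 0, u)].
  rewrite -mulrA ler_wpM2l // mulr_natr -sumr_const.
  rewrite [leRHS](bigID (fun u => u \in root_set T G (o 0) s)) /=.
  rewrite -[leLHS]addr0 lerD //.
    by apply: ler_sum => u /success_start ->.
  by apply: sumr_ge0 => u _; case/andP: (success_itv [:: (u, o 0, u)]).
have -> : (k - 1)%N%:R = k%:R - 1 :> R by rewrite natrB.
have : 0 < N%:R * k%:R :> R by rewrite mulr_gt0 // ltr0n.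
move: K_large N0; nra.
Qed.

(** With a restart valued at [K], a trial together with all later ones costs less than [K], so [K]
    is a consistent bound for the whole loop. *)
Lemma trial_bounded n stk m :
  idle m -> (forall m v, finished m no_output v -> bounded n stk m no_output v) ->
  bounded n (trial o par :: stk) m no_output (K - 1).
Proof.
move=> idl post; do 5 bstep; set m1 := update _ _ _.
have m1_4 : m1 4%N = m1 5%N by [].
have idl1 : idle m1 by case: idl.
have tab := idle_tabled k N idl1 m1_4.
apply: (@bounded_RandVertex _ _ _ _ _ _ _ _ _ _ _
  (fun u => potential [:: (u, o 0, u)] 1 + 16)); last first.
  by have := average_potential; lra.
move=> u; do 5 bstep; set m2 := update _ _ _; apply: append_bounded.
have tab2 : tabled m2 (m1 5%N) ([::] : seq (entry k N)).
  apply: (tabled_same _ tab) => a ha; rewrite /m2 /update /=.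
  by do 3 (case: eqP => [?|_]; first lia).
have tab3 := @append_mem_tabled _ _ m2 _ _ (u, o 0, u) tab2 erefl erefl erefl isT.
do 2 bstep; set m4 := update _ _ _.
apply: bounded_le.
  apply: rounds_bounded post _ _ _ _; split=> //; left.
  exists (m1 5%N), [:: (u, o 0, u)], 1%N; split=> //.
  - exact: Explored_start.
  - by rewrite subn1.
lra.
Qed.

Lemma trials_bounded n m :
  (forall L, explored L k -> P (output_of L)) -> idle m -> m 14%N = 1%N ->
  bounded n [:: While (cell 14) (trial o par); print_table] m no_output K.
Proof.
move=> PL idl m14.
suff loop : forall m out v, finished m out v ->
    bounded n [:: While (cell 14) (trial o par); print_table] m out v.
  by apply: loop; split=> //; right.
apply: bounded_While.
  move=> m' out v [_ [[b [L [_ _ _ ->]]]|[_ _ ->]]]; last exact: K_ge0.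
  by have : (0 : R) <= (size L)%:R; [|lra].
move=> n' m' out v len IH [-> fin] /=.
have IH' m2 v2 : finished m2 no_output v2 ->
    bounded n' [:: While (cell 14) (trial o par); print_table] m2 no_output v2.
  exact: IH.
case: fin => [[b [L [exL tab m14' ->]]]|[idl' m14' ->]]; rewrite m14' /=.
  apply: bounded_le (print_table_bounded _ _ tab (PL _ exL)) _; lra.
exact: trial_bounded idl' IH'.
Qed.

End Loops.

Lemma find_minor_correct eps :
  120 * k%:R * N%:R <= K * guess_prob ^+ s.-1 * #|root_set T G (o 0) s|%:R ->
  almost_surely_outputs nbr R (output_is_minor T G) (start (find_minor o par) N d eps) /\
  (expected_time nbr R (start (find_minor o par) N d eps) <= (K + 5)%:E)%E.
Proof.
move=> K_large; apply: cost_sound => // Lam n _.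
suff : bounded nbr (output_is_minor T G) Lam n [:: find_minor o par]
    (input N d eps) (Output [::] [::]) (K + 5) by apply.
do 5 bstep; apply: (@bounded_le _ _ _ _ _ _ _ _ _ K); last lra.
apply: trials_bounded => //; first by move=> L exL; apply: explored_minor exL.
Qed.

End ExpectedTime.

(** * Numerical bound and conclusion *)

Lemma depth_bound (R : realType) k d (eps : rat) s :
  (0 < k)%N -> (2 <= d)%N -> 0 < eps < 1 -> (s%:R <= 2 * k%:R / eps + 1) ->
  240 * k%:R / ratr eps * 2 ^+ ((s + d + 3) * s.-1) + 5 <=
  ((240 * k + 5)%:R%:P * 'X^((2 * k * (2 * k + 2)).+1)
     : {poly R}).[d%:R `^ depth R k d eps].
Proof.
move=> k0 d2 /andP[eps0 eps1] s_le.
pose E : R := ratr eps; rewrite -/E.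
have E0 : 0 < E by rewrite ltr0q.
have E1 : E < 1 by rewrite -(rmorph1 (ratr : rat -> R)) ltr_rat.
have {}s_le : s%:R <= 2 * k%:R / E + 1 :> R.
  by move: s_le; rewrite -(ler_rat R) rmorphD /= !rmorphM /= fmorphV rmorph1 !ratr_nat.
(* Since D >= y^2, the exponent of 2 is at most (2k + 2) y * 2k y <= [e0 * D]. As d >= 2, the power
   is at most [X ^+ e0], and one more factor [X] absorbs 1 / eps. *)
pose y : R := 16 * d%:R / E.
have kR : (1 : R) <= k%:R by rewrite ler1n.
have dR : (2 : R) <= d%:R by rewrite ler_nat.
have V1 : 1 <= E^-1 by rewrite invf_ge1 // ltW.
have yV : E^-1 <= y by rewrite /y ler_peMl ?invr_ge0 ?ltW //; lra.
have yd : 16 * d%:R <= y by rewrite /y ler_peMr //; lra.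
have D_ge : y ^+ 2 <= depth R k d eps.
  rewrite /depth -/E -/y -[leLHS]mul1r ler_pM ?exprn_ge0 //; [lra|].
  by rewrite ler_weXn2l //; [lra|lia].
set D := depth R k d eps in D_ge *.
pose X : R := d%:R `^ D; rewrite -/X.
have two_le (x : R) : x <= D -> 2 `^ x <= X.
  move=> xD; apply: (@le_trans _ _ (2 `^ D)); first by rewrite ler_powR ?ler1n.
  by apply: ge0_ler_powR; rewrite ?nnegrE //; nra.
have X1 : 1 <= X by rewrite -(powRr0 2); apply: two_le; nra.
have VX : E^-1 <= X.
  have y0 : 0 <= y by lra.
  have /andP[n_le n_gt] := truncn_itv y0.
  apply: (le_trans yV); apply: (le_trans (ltW n_gt)).
  (* Here y < n < 2^n, and n <= y + 1 <= D. *)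
  set n := (Num.truncn y).+1.
  apply: (@le_trans _ _ (2 ^+ n)).
    by rewrite -natrX ler_nat ltnW // ltn_expl.
  by rewrite -powR_mulrn //; apply: two_le; rewrite /n -natr1; nra.
pose e0 := (2 * k * (2 * k + 2))%N.
have MX : 2 ^+ ((s + d + 3) * s.-1) <= X ^+ e0.
  have s1 : s.-1%:R <= 2 * k%:R * y.
    case: (s) s_le => [|s'] /=; first by rewrite mulr_ge0 //; nra.
    by rewrite -natr1 lerD2r => /le_trans; apply; rewrite ler_wpM2l // mulr_ge0.
  have s2 : (s + d + 3)%N%:R <= (2 * k%:R + 2) * y.
    rewrite !natrD.
    have : 2 * k%:R / E <= 2 * k%:R * y by rewrite ler_wpM2l // mulr_ge0.
    lra.
  have le : ((s + d + 3) * s.-1)%N%:R <= e0%:R * D.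
    rewrite natrM; apply: (@le_trans _ _ ((2 * k%:R + 2) * y * (2 * k%:R * y))).
      by rewrite ler_pM.
    apply: (@le_trans _ _ (e0%:R * y ^+ 2)); last by rewrite ler_wpM2l.
    by rewrite /e0 !(natrM, natrD); lra.
  rewrite -[leLHS]powR_mulrn //; apply: (@le_trans _ _ (2 `^ (D * e0%:R))).
    by rewrite ler_powR ?ler1n // mulrC.
  rewrite powRrM powR_mulrn ?powR_ge0 //.
  by rewrite lerXn2r ?nnegrE ?powR_ge0 //; exact: two_le.
rewrite hornerCM hornerXn -/e0 exprS.
have XX : E^-1 * 2 ^+ ((s + d + 3) * s.-1) <= X * X ^+ e0.
  by rewrite ler_pM ?invr_ge0 ?exprn_ge0 // ltW.
have XX1 : 1 <= X * X ^+ e0 by rewrite -exprS exprn_ege1.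
have kXX := ler_wpM2l (mulr_ge0 (ler0n R 240) (ler0n R k)) XX.
by rewrite natrD natrM -(mulrA (240 * k%:R)); lra.
Qed.

Theorem theorem1p3 (R : realType) (k : nat) (T : sgraph 'I_k)
    (treeT : is_tree T) :
  exists (A : cmd) (p : {poly R}),
  forall (N d : nat) (eps : rat) (G : sgraph 'I_N) (nbr : 'I_N -> seq 'I_N),
    (2 <= d)%N -> 0 < eps ->
    max_degree_le G d -> neighbor_lists G nbr ->
    far_from_minor_free T d eps G ->
    almost_surely_outputs nbr R (output_is_minor T G) (start A N d eps) /\
    (expected_time nbr R (start A N d eps)
       <= (p.[d%:R `^ depth R k d eps])%:E)%E.
Proof.
have [ord [idx [par [idxP idxK par_lt parT parP]]]] := tree_order treeT.
rewrite card_ord in idxP idxK parT parP.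
exists (find_minor ord par), ((240 * k + 5)%:R%:P * 'X^((2 * k * (2 * k + 2)).+1)).
move=> N d eps G nbr d2 eps0 degG nbrG far.
have k0 : (0 < k)%N by have [[]] := treeT; rewrite card_ord.
have N0 := far_N_gt0 treeT far.
have d0 : (0 < d)%N by exact: leq_trans d2.
suff [s [K [K0 Klarge Kle]]] : exists s (K : R), [/\ 0 <= K,
    120 * k%:R * N%:R <= K * guess_prob R d s ^+ s.-1 * #|root_set T G (ord 0) s|%:R &
    K + 5 <= ((240 * k + 5)%:R%:P * 'X^((2 * k * (2 * k + 2)).+1)
                : {poly R}).[d%:R `^ depth R k d eps]].
  have [as_out etime] := find_minor_correct treeT idxP idxK par_lt parT parP
    nbrG degG N0 K0 eps Klarge.
  by split=> //; apply: le_trans etime _; rewrite lee_fin.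
(* A single vertex is a model by itself, so s = 1 works for every [eps]. For larger trees an edge of
   [T] yields [eps < 1]. *)
have [k1|k1] := leqP k 1%N.
  have kE : k = 1%N by lia.
  subst k; exists 1%N, 120; split=> //.
    by rewrite root_set_single cardsT card_ord mulr1.
  have : (1 : R) <= d%:R `^ depth R 1 d eps.
    rewrite -[leLHS](powRr0 d%:R) ler_powR ?ler1n //.
    have E0 : 0 <= ratr eps :> R by rewrite ler0q ltW.
    by rewrite /depth mul1r exprn_ge0 // divr_ge0 // mulr_ge0.
  set X := _ `^ _ => X1; rewrite hornerCM hornerXn.
  by have : 1 <= X ^+ (2 * 1 * (2 * 1 + 2)).+1; [exact: exprn_ege1|lra].
have eps1 : eps < 1.
  by apply: (far_eps_lt1 (o := ord) (par := par)) far => //; exact: parT.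
(* The least integer above 2k / eps, so that [far_root_set] applies. *)
pose s := (Num.truncn (2 * k%:R / eps)).+1.
have q0 : 0 <= 2 * k%:R / eps :> rat by rewrite divr_ge0 ?mulr_ge0 // ltW.
have /andP[s_le s_gt] := truncn_itv q0; rewrite -/s in s_gt.
have E0 : 0 < ratr eps :> R by rewrite ltr0q.
(* [K] is 240 k / eps divided by the success bound of a good start; good starts make up at least a
   fraction eps / 2 of all vertices, which gives [120 * k * N]. *)
exists s, (240 * k%:R / ratr eps * 2 ^+ ((s + d + 3) * s.-1)); split.
- by apply: mulr_ge0; [apply: divr_ge0; [exact: mulr_ge0|exact: ltW]|exact: exprn_ge0].
- have large : 2%:R * k%:R <= eps * s%:R.
    by move: (ltW s_gt); rewrite ler_pdivrMr // [eps * _]mulrC.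
  have := far_root_set (ord 0) treeT k1 d0 eps0 degG far large.
  rewrite -(ler_rat R) !rmorphM /= !ratr_nat => farM.
  rewrite /guess_prob -exprVn -exprM exprVn mulfK ?expf_neq0 //.
  apply: (@le_trans _ _ (120 * k%:R / ratr eps * (ratr eps * N%:R))).
    by rewrite mulrA divfK // gt_eqF.
  apply: (@le_trans _ _ (120 * k%:R / ratr eps * (2%:R * #|root_set T G (ord 0) s|%:R))).
    by apply: ler_wpM2l farM; apply: divr_ge0; [exact: mulr_ge0|exact: ltW].
  by rewrite le_eqVlt; apply/orP; left; apply/eqP; ring.
- apply: depth_bound => //; first by rewrite eps0.
  by rewrite /s -natr1 lerD2r.
Qed.
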